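(* Let $k,l,N$ be positive integers with at least one of $k,l$ odd. Suppose proper distributions $\varphi_1,\dots,\varphi_N$ on $\mathbb{T}^2$ satisfy $$-\partial_1^k\varphi_1=\mu_0,\qquad \partial_2^l\varphi_j-\partial_1^k\varphi_{j+1}=\mu_j\ (j=1,\dots,N-1),\qquad \partial_2^l\varphi_N=\mu_N,$$ where $\mu_0,\dots,\mu_N$ are (finite complex Borel) measures on $\mathbb{T}^2$. Then $$\sum_{j=1}^N\|\varphi_j\|_{W_2^{\frac{k-1}{2},\frac{l-1}{2}}(\mathbb{T}^2)}\leqslant C\sum_{j=0}^N\|\mu_j\|,$$ where $C$ does not depend on the $\varphi_j$ and $\mu_j$.
   Context: The torus is parametrised by $t\mapsto e^{2\pi i t}$, $\partial_1,\partial_2$ are the derivatives with respect to the two parameters, and Fourier coefficients are $\hat f(m,n)$, $(m,n)\in\mathbb{Z}^2$, with respect to the system $e^{2\pi i(mt_1+nt_2)}$. A distribution $f$ on $\mathbb{T}^2$ is called proper if $\hat f(s,t)=0$ whenever $s=0$ or $t=0$. For $\alpha,\beta\geqslant 0$, $W_2^{\alpha,\beta}(\mathbb{T}^2)$ is the space of distributions $f$ with $\{(1+m^2)^{\alpha/2}(1+n^2)^{\beta/2}\hat f(m,n)\}\in l^2(\mathbb{Z}^2)$, normed by the $l^2$-norm of this sequence. The norm $\|\mu\|$ of a measure is its total variation. *)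

(* Defs.v *)
From HB Require Import structures.
From mathcomp Require Import all_boot all_order all_algebra.
From mathcomp Require Import all_classical all_reals all_analysis.
From mathcomp Require Import complex.
Set Implicit Arguments. Unset Strict Implicit. Unset Printing Implicit Defensive.
Import Order.TTheory GRing.Theory Num.Theory.
Import numFieldNormedType.Exports.
Local Open Scope classical_set_scope.
Local Open Scope ring_scope.

Section Defs.
Variable R : realType.
Local Notation C := (R[i]).
Local Open Scope complex_scope.

Definition cabs (z : C) : R := Num.sqrt (complex.Re z ^+ 2 + complex.Im z ^+ 2).

(* The torus T^2 is identified with [0,1)^2 via (t1,t2) |-> (e^{2 pi i t1}, e^{2 pi i t2}). *)
Definition torus_dom : set (R * R)%type := `[0%R, 1%R[%classic `*` `[0%R, 1%R[%classic.

(* A distribution on T^2, given by its Fourier coefficients f^(m,n) w.r.t.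
   e^{2 pi i (m t1 + n t2)}; distributions on T^2 are exactly the
   Fourier series with coefficients of polynomial growth. *)
Definition is_distribution (f : int -> int -> C) : Prop :=
  exists (K : R) (s : nat), forall m n : int,
    cabs (f m n) <= K * (1 + `|m%:~R| + `|n%:~R|) ^+ s.

Definition proper_distr (f : int -> int -> C) : Prop :=
  forall m n : int, (m = 0 \/ n = 0)%R -> f m n = 0.

(* Fourier multiplier of d/dt : e^{2 pi i m t} -> (2 pi i m) e^{2 pi i m t} *)
Definition dmul (k : nat) (m : int) : C := ((0 : R) +i* (2 * pi * m%:~R)) ^+ k.

(* A finite complex Borel measure on T^2 (= on [0,1)^2), written via its
   Jordan-type decomposition mu = (nu1 - nu2) + i (nu3 - nu4) with finite
   positive Borel measures; only the restriction to [0,1)^2 is used. *)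
Record cmeasure := CMeasure {
  cm1 : {finite_measure set (R * R)%type -> \bar R};
  cm2 : {finite_measure set (R * R)%type -> \bar R};
  cm3 : {finite_measure set (R * R)%type -> \bar R};
  cm4 : {finite_measure set (R * R)%type -> \bar R} }.

Definition cm_val (mu : cmeasure) (E : set (R * R)%type) : C :=
  (fine (cm1 mu E) - fine (cm2 mu E)) +i* (fine (cm3 mu E) - fine (cm4 mu E)).

Definition cm_norm (mu : cmeasure) : \bar R :=
  ereal_sup [set (\sum_(E <- s) cabs (cm_val mu E))%:E | s in
    [set s : seq (set (R * R)%type) |
       (forall E, E \in s -> measurable E /\ E `<=` torus_dom) /\
       (forall i j : nat, (i < j < size s)%N -> nth set0 s i `&` nth set0 s j = set0)]].

Definition phase (m n : int) (t : R * R) : R :=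
  2 * pi * (m%:~R * t.1 + n%:~R * t.2).

Definition fcoef_pos (nu : {finite_measure set (R * R)%type -> \bar R}) (m n : int) : C :=
  (Rintegral nu torus_dom (fun t => cos (phase m n t)))
  +i* (- Rintegral nu torus_dom (fun t => sin (phase m n t))).

Definition fcoef (mu : cmeasure) (m n : int) : C :=
  fcoef_pos (cm1 mu) m n - fcoef_pos (cm2 mu) m n
  + 'i * (fcoef_pos (cm3 mu) m n - fcoef_pos (cm4 mu) m n).

Definition W2norm (a b : R) (f : int -> int -> C) : \bar R :=
  let S := (\esum_(p in [set: int * int])
             (((1 + p.1%:~R ^+ 2) `^ (a / 2) * (1 + p.2%:~R ^+ 2) `^ (b / 2)
               * cabs (f p.1 p.2)) ^+ 2)%:E)%E in
  match S with
  | EFin r => (Num.sqrt r)%:E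
  | _ => +oo%E
  end.

End Defs.

(* Main.v *)
Require Import Defs.
From HB Require Import structures.
From mathcomp Require Import all_boot all_order all_algebra.
From mathcomp Require Import all_classical all_reals all_analysis.
From mathcomp Require Import measurable_realfun complex.
From mathcomp Require Import ring lra zify.
Import Order.TTheory GRing.Theory Num.Theory.
Import numFieldNormedType.Exports.
Set Implicit Arguments.
Unset Strict Implicit.
Unset Printing Implicit Defensive.
Local Open Scope classical_set_scope.
Local Open Scope ring_scope.
Local Open Scope complex_scope.

(* Write [u_j] for the Fourier coefficients of [mu_j] and [a = (2 pi i m)^k],
   [b = (2 pi i n)^l]. The equations say that the vector [u(m, n)] is orthogonal
   to [(1, z, ..., z^N)] with [z = a / b], a quantity depending only on
   [m^k / n^l]. For a fixed node [z_i], average [|sum_j z_i^j u_j|^2] over a big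
   box of sides [~ t^l, t^k] and over a small box at the same scale, located
   where [a / b] is close to [z_i]. The difference of the two averages is a
   quadratic form whose kernel vanishes at the origin, and the sum over [t] with
   weights [1 / t] of these kernels is bounded, so the summed form is at most
   [C (sum_j ||mu_j||)^2]. The subtracted small boxes contribute little, as
   [sum_j z_i^j u_j] is small there, whereas the big boxes for [N + 1] distinct
   nodes control all of [|u|^2] by invertibility of the Vandermonde matrix, with
   exactly the weight needed for the Sobolev norms of the [phi_j]. *)

(** * Complex exponentials and means over intervals of frequencies *)

(** The subtraction is forced: for a point mass [|u|] is constant, so each big box alone contributes
    of order [1 / t] and the sum over scales diverges logarithmically. The price is a negative term,
    and the parameter [A] makes it affordable. With [S = A t], the small box of index [a] has its
    corner at [(a S^l, S^k)], where [m^k / n^l] is exactly [a^k], and sides [S^l / A] and [S^k / A],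
    so the node value there is [O(1 / A)]. Its density exceeds that of the big box by a factor of
    order [A^2], but a given frequency is seen by only a proportion [1 / A] of the scales. Squared
    value, density and proportion multiply to [O(1 / A)], which beats the Vandermonde constant once
    [A] is large. *)

Section ComplexModulus.
Variable R : realType.
Implicit Types (z w : R[i]) (x y : R).

Lemma cabsE z : cabs z = Normc.normc z.
Proof. by case: z. Qed.

Lemma cabs_ge0 z : 0 <= cabs z.
Proof. exact: sqrtr_ge0. Qed.

Lemma cabs0 : cabs (0 : R[i]) = 0.
Proof. by rewrite cabsE Normc.normc0. Qed.

Lemma cabs1 : cabs (1 : R[i]) = 1.
Proof. by rewrite cabsE Normc.normc1. Qed.

Lemma cabsM z w : cabs (z * w) = cabs z * cabs w.
Proof. by rewrite !cabsE Normc.normcM. Qed.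

Lemma cabsD z w : cabs (z + w) <= cabs z + cabs w.
Proof. by rewrite !cabsE (le_normcD z w). Qed.

Lemma cabsN z : cabs (- z) = cabs z.
Proof. by rewrite !cabsE normcN. Qed.

Lemma cabsB z w : cabs (z - w) <= cabs z + cabs w.
Proof. by rewrite -(cabsN w) cabsD. Qed.

Lemma cabsX z n : cabs (z ^+ n) = cabs z ^+ n.
Proof. by elim: n => [|n IH]; rewrite ?expr0 ?cabs1 // !exprS cabsM IH. Qed.

Lemma cabs_real x : cabs x%:C = `|x|.
Proof. by rewrite /cabs /= expr0n addr0 sqrtr_sqr. Qed.

Lemma cabs_conj z : cabs z^* = cabs z.
Proof. by case: z => a b; rewrite /cabs /= sqrrN. Qed.

Lemma cabs_sum (I : Type) (r : seq I) (P : pred I) (F : I -> R[i]) :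
  cabs (\sum_(i <- r | P i) F i) <= \sum_(i <- r | P i) cabs (F i).
Proof.
elim/big_ind2 : _ => [|z x w y zx wy|//]; first by rewrite cabs0.
by apply: le_trans (cabsD _ _) _; rewrite lerD.
Qed.

Lemma sqr_cabs z : (cabs z ^+ 2)%:C = z * z^*.
Proof.
case: z => a b; rewrite /cabs /= sqr_sqrtr ?addr_ge0 ?sqr_ge0 //.
by apply/eqP; rewrite eq_complex /=; apply/andP; split; apply/eqP; ring.
Qed.

Lemma Re_le_cabs z : `|complex.Re z| <= cabs z.
Proof.
by rewrite -sqrtr_sqr /cabs ler_sqrt ?lerDl ?sqr_ge0 // addr_ge0 ?sqr_ge0.
Qed.

Lemma Im_le_cabs z : `|complex.Im z| <= cabs z.
Proof.
by rewrite -sqrtr_sqr /cabs ler_sqrt ?lerDr ?sqr_ge0 // addr_ge0 ?sqr_ge0.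
Qed.

Lemma cabs_le_ReIm z : cabs z <= `|complex.Re z| + `|complex.Im z|.
Proof.
rewrite -[leRHS]ger0_norm ?addr_ge0 // -sqrtr_sqr /cabs ler_sqrt ?sqr_ge0 //.
rewrite sqrrD !real_normK ?num_real // lerD2r lerDl.
by rewrite mulrn_wge0 // mulr_ge0.
Qed.

End ComplexModulus.

Section Exponential.
Variable R : realType.
Implicit Types (x y : R) (m n : int).

Definition expi x : R[i] := cos x +i* sin x.

Lemma expiD x y : expi (x + y) = expi x * expi y.
Proof.
rewrite /expi cosD sinD; apply/eqP; rewrite eq_complex /=.
by apply/andP; split; apply/eqP; ring.
Qed.

Lemma expi0 : expi 0 = 1.
Proof. by rewrite /expi cos0 sin0. Qed.

Lemma expiN x : expi (- x) = (expi x)^*.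
Proof. by rewrite /expi cosN sinN. Qed.

Lemma cabs_expi x : cabs (expi x) = 1.
Proof. by rewrite /cabs /= cos2Dsin2 sqrtr1. Qed.

Lemma expiMn x (n : nat) : expi (n%:R * x) = expi x ^+ n.
Proof.
elim: n => [|n IH]; first by rewrite mul0r expi0.
by rewrite -natr1 mulrDl mul1r expiD IH exprSr.
Qed.

Lemma cabs_expX_sub1 (z : R[i]) (n : nat) :
  cabs z = 1 -> cabs (z ^+ n - 1) <= n%:R * cabs (z - 1).
Proof.
move=> z1; elim: n => [|n IH]; first by rewrite expr0 subrr cabs0 mul0r.
have -> : z ^+ n.+1 - 1 = z * (z ^+ n - 1) + (z - 1) by rewrite exprS; ring.
apply: le_trans (cabsD _ _) _; rewrite cabsM z1 mul1r -natr1 mulrDl mul1r.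
by rewrite lerD2r.
Qed.

Lemma cabs_expi_sub1 m x :
  cabs (expi (m%:~R * x) - 1) <= `|m|%N%:R * cabs (expi x - 1).
Proof.
have key (n : nat) : cabs (expi (n%:R * x) - 1) <= n%:R * cabs (expi x - 1).
  by rewrite expiMn cabs_expX_sub1 // cabs_expi.
case: m => n /=; first exact: key.
rewrite NegzE mulrNz mulNr expiN; apply: le_trans (key n.+1).
by rewrite -[leRHS]cabs_conj rmorphB rmorph1.
Qed.

(** Normalised Dirichlet kernel: the Fourier transform of the uniform probability on the frequencies
    [M, ..., M + L - 1]. *)
Definition interval_mean (M : int) (L : nat) x : R[i] :=
  (L%:R^-1)%:C * \sum_(j < L) expi ((M + j%:Z)%:~R * x).

Lemma cabs_interval_mean_le1 M L x : cabs (interval_mean M L x) <= 1.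
Proof.
rewrite cabsM cabs_real ger0_norm ?invr_ge0 //.
case: L => [|L]; first by rewrite big_ord0 cabs0 mulr0.
rewrite ler_pdivrMl ?ltr0n // mulr1; apply: le_trans (cabs_sum _ _ _) _.
under eq_bigr do rewrite cabs_expi.
by rewrite sumr_const card_ord.
Qed.

Lemma cabs_interval_mean_sub1 M L x : (0 < L)%N ->
  cabs (interval_mean M L x - 1) <= (`|M|%N + L)%:R * cabs (expi x - 1).
Proof.
move=> L0; have L0' : 0 < L%:R :> R by rewrite ltr0n.
have -> : interval_mean M L x - 1 =
    (L%:R^-1)%:C * \sum_(j < L) (expi ((M + j%:Z)%:~R * x) - 1).
  rewrite sumrB mulrBr; congr (_ - _).
  have LE : L%:R = (L%:R : R)%:C by rewrite rmorph_nat.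
  by rewrite sumr_const card_ord LE -rmorphM mulVf ?rmorph1 // gt_eqF.
rewrite cabsM cabs_real ger0_norm ?invr_ge0 ?ler0n //.
rewrite ler_pdivrMl //; apply: le_trans (cabs_sum _ _ _) _.
apply: (@le_trans _ _ (\sum_(j < L) (`|M|%N + L)%:R * cabs (expi x - 1))).
  apply: ler_sum => j _; apply: le_trans (cabs_expi_sub1 _ _) _.
  by rewrite ler_wpM2r ?cabs_ge0 // ler_nat; have := ltn_ord j; lia.
by rewrite sumr_const card_ord [leRHS]mulr_natl.
Qed.

(** Multiplying the geometric sum by [e^{ix} - 1] leaves a difference of two numbers of modulus
    1. *)
Lemma cabs_interval_mean_decay M L x :
  L%:R * cabs (expi x - 1) * cabs (interval_mean M L x) <= 2.
Proof.
case: L => [|L]; first by rewrite mul0r mul0r.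
have -> : interval_mean M L.+1 x =
    (L.+1%:R^-1)%:C * (expi (M%:~R * x) * \sum_(j < L.+1) expi x ^+ j).
  congr (_ * _); rewrite mulr_sumr; apply: eq_bigr => j _.
  by rewrite intrD mulrDl expiD -[j%:~R]/(j%:R) expiMn.
rewrite !cabsM cabs_real cabs_expi mul1r ger0_norm ?invr_ge0 //.
rewrite mulrACA divff ?pnatr_eq0 // mul1r -cabsM -subrX1.
by apply: le_trans (cabsB _ _) _; rewrite cabsX cabs_expi expr1n cabs1.
Qed.

End Exponential.

(** * Integration against complex measures *)

Section IntegralComplexMeasure.
Variable R : realType.
Implicit Types (nu : {finite_measure set (R * R)%type -> \bar R}).
Implicit Types (u v : R * R -> R) (f g : R * R -> R[i]) (mu : cmeasure R).
Local Notation D := (@torus_dom R).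
Local Notation Re := (@complex.Re R).
Local Notation Im := (@complex.Im R).

Lemma measurable_torus_dom : measurable D.
Proof. by apply: measurableX; exact: measurable_itv. Qed.

Definition bounded_measurable u :=
  measurable_fun setT u /\ exists B, forall t, `|u t| <= B.

Lemma bounded_measurable_integrable nu u :
  bounded_measurable u -> nu.-integrable D (EFin \o u).
Proof.
case=> mu [B uB]; apply: measurable_bounded_integrable.
- exact: measurable_torus_dom.
- by rewrite ltey_eq fin_num_measure //; exact: measurable_torus_dom.
- exact: measurable_funTS.
- exists B; split; first exact: num_real.
  by move=> x Bx t _ /=; apply: le_trans (uB t) (ltW Bx).
Qed.

Lemma bounded_measurableD u v : bounded_measurable u -> bounded_measurable v ->
  bounded_measurable (fun t => u t + v t).
Proof.
case=> mu [B uB] [mv [B' vB]]; split; first exact: measurable_funD.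
by exists (B + B') => t; apply: le_trans (ler_normD _ _) _; rewrite lerD.
Qed.

Lemma bounded_measurableZ r u : bounded_measurable u ->
  bounded_measurable (fun t => r * u t).
Proof.
case=> mu [B uB]; split; first exact: measurable_funM.
by exists (`|r| * B) => t; rewrite normrM ler_wpM2l.
Qed.

Definition cbounded_measurable f :=
  bounded_measurable (Re \o f) /\ bounded_measurable (Im \o f).

Lemma eq_bounded_measurable u v : u =1 v ->
  bounded_measurable u -> bounded_measurable v.
Proof. by move=> /funext ->. Qed.

Lemma cbounded_measurableD f g :
  cbounded_measurable f -> cbounded_measurable g ->
  cbounded_measurable (fun t => f t + g t).
Proof.
move=> [f1 f2] [g1 g2]; split.
  apply: eq_bounded_measurable (bounded_measurableD f1 g1) => t /=.
  by rewrite raddfD.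
apply: eq_bounded_measurable (bounded_measurableD f2 g2) => t /=.
by rewrite raddfD.
Qed.

Lemma ReMc (z w : R[i]) : Re (z * w) = Re z * Re w + - Im z * Im w.
Proof. by case: z w => a b [c d] /=; ring. Qed.

Lemma ImMc (z w : R[i]) : Im (z * w) = Re z * Im w + Im z * Re w.
Proof. by case: z w => a b [c d] /=; ring. Qed.

Lemma cbounded_measurableZ c f : cbounded_measurable f ->
  cbounded_measurable (fun t => c * f t).
Proof.
move=> [f1 f2]; split.
  apply: eq_bounded_measurable (bounded_measurableD
    (bounded_measurableZ (Re c) f1) (bounded_measurableZ (- Im c) f2)) => t /=.
  by rewrite ReMc.
apply: eq_bounded_measurable (bounded_measurableD
  (bounded_measurableZ (Re c) f2) (bounded_measurableZ (Im c) f1)) => t /=.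
by rewrite ImMc.
Qed.

Lemma cbounded_measurable0 : cbounded_measurable (fun=> 0).
Proof.
by split; (split; [exact: measurable_cst|exists 0 => t /=; rewrite normr0]).
Qed.

Lemma cbounded_measurable_sum (I : Type) (s : seq I) (F : I -> R * R -> R[i]) :
  (forall i, cbounded_measurable (F i)) ->
  cbounded_measurable (fun t => \sum_(i <- s) F i t).
Proof.
move=> mF; elim: s => [|i s IH].
  under eq_fun do rewrite big_nil.
  exact: cbounded_measurable0.
under eq_fun do rewrite big_cons.
exact: cbounded_measurableD.
Qed.

Definition cint_pos nu f : R[i] :=
  Rintegral nu D (Re \o f) +i* Rintegral nu D (Im \o f).

(** Gives [fcoef] on characters and [cm_val] on indicators, which is how Fourier coefficients get
    related to the total variation. *)
Definition cint mu f : R[i] :=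
  cint_pos (cm1 mu) f - cint_pos (cm2 mu) f
  + 'i * (cint_pos (cm3 mu) f - cint_pos (cm4 mu) f).

Lemma cint_posD nu f g : cbounded_measurable f -> cbounded_measurable g ->
  cint_pos nu (fun t => f t + g t) = cint_pos nu f + cint_pos nu g.
Proof.
move=> [f1 f2] [g1 g2]; rewrite /cint_pos.
have -> : Re \o (fun t => f t + g t) = fun t => (Re \o f) t + (Re \o g) t.
  by apply/funext => t /=; rewrite raddfD.
have -> : Im \o (fun t => f t + g t) = fun t => (Im \o f) t + (Im \o g) t.
  by apply/funext => t /=; rewrite raddfD.
have mD := measurable_torus_dom.
by rewrite !RintegralD //; exact: bounded_measurable_integrable.
Qed.

Lemma cint_posZ nu c f : cbounded_measurable f ->
  cint_pos nu (fun t => c * f t) = c * cint_pos nu f.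
Proof.
move=> [f1 f2]; rewrite /cint_pos; have mD := measurable_torus_dom.
have -> : Re \o (fun t => c * f t) =
    fun t => Re c * (Re \o f) t + - Im c * (Im \o f) t.
  by apply/funext => t /=; rewrite ReMc.
have -> : Im \o (fun t => c * f t) =
    fun t => Re c * (Im \o f) t + Im c * (Re \o f) t.
  by apply/funext => t /=; rewrite ImMc.
rewrite !RintegralD //; do ?exact/bounded_measurable_integrable/bounded_measurableZ.
rewrite !RintegralZl //; do ?exact/bounded_measurable_integrable.
by case: c => a b; apply/eqP; rewrite eq_complex /= mulNr !eqxx.
Qed.

Lemma cintD mu f g : cbounded_measurable f -> cbounded_measurable g ->
  cint mu (fun t => f t + g t) = cint mu f + cint mu g.
Proof. by move=> mf mg; rewrite /cint !cint_posD //; ring. Qed.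

Lemma cintZ mu c f : cbounded_measurable f ->
  cint mu (fun t => c * f t) = c * cint mu f.
Proof. by move=> mf; rewrite /cint !cint_posZ //; ring. Qed.

Lemma cint_pos0 nu : cint_pos nu (fun=> 0) = 0.
Proof.
have := cint_posZ nu 0 cbounded_measurable0.
by under eq_fun do rewrite mul0r; rewrite mul0r.
Qed.

Lemma cint0 mu : cint mu (fun=> 0) = 0.
Proof. by rewrite /cint !cint_pos0 !subrr mulr0 addr0. Qed.

Lemma cint_sum (I : Type) (s : seq I) (F : I -> R * R -> R[i]) mu :
  (forall i, cbounded_measurable (F i)) ->
  cint mu (fun t => \sum_(i <- s) F i t) = \sum_(i <- s) cint mu (F i).
Proof.
move=> mF; elim: s => [|i s IH].
  by under eq_fun do rewrite big_nil; rewrite big_nil cint0.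
under eq_fun do rewrite big_cons.
by rewrite big_cons cintD // ?IH //; exact: cbounded_measurable_sum.
Qed.

Lemma cbounded_measurable_indic (E : set (R * R)) : measurable E ->
  cbounded_measurable (fun t => (\1_E t)%:C).
Proof.
move=> mE; split; split.
- exact: measurable_indic.
- exists 1 => t /=; rewrite indicE; case: (_ \in _) => /=;
    by rewrite ?normr1 ?normr0.
- exact: measurable_cst.
- by exists 0 => t /=; rewrite normr0.
Qed.

Lemma cint_pos_indic nu (E : set (R * R)) : measurable E -> E `<=` D ->
  cint_pos nu (fun t => (\1_E t)%:C) = (fine (nu E))%:C.
Proof.
move=> mE ED; have mD := measurable_torus_dom.
rewrite /cint_pos; apply/eqP; rewrite eq_complex /=; apply/andP; split.
  by rewrite /Rintegral integral_indic // (setIidl ED).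
by rewrite /Rintegral /= integral0.
Qed.

Lemma cint_indic mu (E : set (R * R)) : measurable E -> E `<=` D ->
  cint mu (fun t => (\1_E t)%:C) = cm_val mu E.
Proof.
move=> mE ED; rewrite /cint !cint_pos_indic //; apply/eqP.
by rewrite eq_complex /=; apply/andP; split; apply/eqP; ring.
Qed.

Lemma cabs_cint_pos nu f (B : R) : cbounded_measurable f ->
  (forall t, D t -> cabs (f t) <= B) ->
  cabs (cint_pos nu f) <= 2 * B * fine (nu D).
Proof.
move=> [f1 f2] fB; have mD := measurable_torus_dom.
have key u : bounded_measurable u -> (forall t, D t -> `|u t| <= B) ->
    `|Rintegral nu D u| <= B * fine (nu D).
  move=> mu uB; rewrite -Rintegral_cst //.
  apply: le_trans (le_normr_Rintegral mD _) _.
    exact: bounded_measurable_integrable.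
  apply: le_Rintegral => //; apply: bounded_measurable_integrable.
    case: mu => mu [B' uB']; split; first exact: measurableT_comp.
    by exists B' => t; rewrite normr_id.
  by split; [exact: measurable_cst|exists `|B|].
apply: le_trans (cabs_le_ReIm _) _ => /=; rewrite -mulrA mulr2n mulrDl mul1r.
by apply: lerD; apply: key => // t Dt; apply: le_trans (fB t Dt);
  [exact: Re_le_cabs|exact: Im_le_cabs].
Qed.

(** The four positive parts need not be mutually singular, so this mass can far exceed the total
    variation. It only ever multiplies an error that is made arbitrarily small. *)
Definition cmass mu : R := fine (cm1 mu D) + fine (cm2 mu D) +
  (fine (cm3 mu D) + fine (cm4 mu D)).

Lemma cabs_cint_crude mu f (B : R) : cbounded_measurable f ->
  (forall t, D t -> cabs (f t) <= B) ->
  cabs (cint mu f) <= 2 * B * cmass mu.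
Proof.
move=> mf fB; rewrite /cint /cmass.
apply: le_trans (cabsD _ _) _; rewrite cabsM.
have -> : cabs ('i : R[i]) = 1.
  by rewrite /cabs /= expr0n expr1n add0r sqrtr1.
rewrite mul1r !mulrDr; apply: lerD; apply: le_trans (cabsB _ _) _;
  apply: lerD; exact: cabs_cint_pos.
Qed.

Lemma cmass_ge0 mu : 0 <= cmass mu.
Proof. by rewrite /cmass !addr_ge0 // fine_ge0. Qed.

End IntegralComplexMeasure.

(** * Integrals bounded by the total variation *)

Section TotalVariationBound.
Variable R : realType.
Implicit Types (f : R * R -> R[i]) (mu : cmeasure R).
Local Notation D := (@torus_dom R).
Local Notation Re := (@complex.Re R).
Local Notation Im := (@complex.Im R).

Lemma sum_cm_val_le mu (W : R) n (E : nat -> set (R * R)) :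
  cm_norm mu = W%:E ->
  (forall i, measurable (E i) /\ E i `<=` D) ->
  (forall i j, (i < j)%N -> E i `&` E j = set0) ->
  \sum_(i < n) cabs (cm_val mu (E i)) <= W.
Proof.
move=> muW mE dE; rewrite -lee_fin -muW; apply: ereal_sup_ubound.
exists [seq E i | i <- iota 0 n]; last first.
  by rewrite big_map -[n in iota 0 n]subn0 big_mkord.
split=> [F /mapP[i _ ->] //|i j]; rewrite size_map size_iota => /andP[ij jn].
have ni : (i < n)%N by apply: ltn_trans jn.
by rewrite !(nth_map 0%N) ?size_iota // !nth_iota // !add0n dE.
Qed.

(* [f] is approximated by a simple function constant on the level sets of the
   integer parts of its rescaled real and imaginary parts. *)
Lemma cabs_cint_approx mu f (B W e : R) : cbounded_measurable f ->
  (forall t, D t -> cabs (f t) <= B) -> cm_norm mu = W%:E -> 0 < e ->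
  cabs (cint mu f) <= B * W + 2 * (2 * e) * cmass mu.
Proof.
move=> mf fB muW e0; have mD : measurable D := @measurable_torus_dom R.
have D0 : D (0, 0) by split; rewrite /= in_itv /= lexx ltr01.
have B0 : 0 <= B by apply: le_trans (fB _ D0); exact: cabs_ge0.
(* [P] slabs of height [e] cover [[-B, B]]. A cell is a pair of slabs, coded by quotient and
   remainder as one index below [P * P]. *)
pose P := (Num.truncn (2 * B / e)).+1.
pose slab (u : R * R -> R) p := [set t | (p%:R <= (u t + B) / e < p.+1%:R)].
have slab_uniq u p p' t : slab u p t -> slab u p' t -> p = p'.
  by rewrite /slab /= => /truncn_def <- /truncn_def <-.
have mslab u p : bounded_measurable u -> measurable (slab u p).
  move=> [mu' _]; have mh : measurable_fun setT (fun t => (u t + B) / e).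
    by apply: measurable_funM => //; apply: measurable_funD.
  have -> : slab u p = setT `&` (fun t => (u t + B) / e) @^-1`
      `[p%:R, p.+1%:R[%classic.
    by rewrite setTI; apply/seteqP; split=> t /=; rewrite in_itv.
  by apply: mh => //; exact: measurable_itv.
have ex_slab u t : `|u t| <= B -> exists2 p, (p < P)%N & slab u p t.
  move=> uB; have x0 : 0 <= (u t + B) / e.
    apply: divr_ge0; last exact: ltW.
    by move: uB; rewrite ler_norml => /andP[? ?]; lra.
  exists (Num.truncn ((u t + B) / e)); last exact: truncn_itv.
  rewrite ltnS le_truncn // ler_pM2r ?invr_gt0 //.
  by move: uB; rewrite ler_norml => /andP[? ?]; lra.
have slab_close u p t t' : slab u p t -> slab u p t' -> `|u t - u t'| <= e.
  rewrite /slab /= !ler_pdivlMr // !ltr_pdivrMr // -natr1 mulrDl mul1r.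
  by move=> /andP[? ?] /andP[? ?]; rewrite ler_norml; apply/andP; split; lra.

pose E i := D `&` (slab (Re \o f) (i %/ P)%N `&` slab (Im \o f) (i %% P)%N).
have mE i : measurable (E i) /\ E i `<=` D.
  split; last exact: subIsetl.
  case: mf => f1 f2; apply: measurableI => //.
  by apply: measurableI; exact: mslab.
have E_uniq i j t : E i t -> E j t -> i = j.
  move=> [_ [a1 a2]] [_ [b1 b2]].
  by rewrite (divn_eq i P) (divn_eq j P) (slab_uniq _ _ _ _ a1 b1)
    (slab_uniq _ _ _ _ a2 b2).
have dE i j : (i < j)%N -> E i `&` E j = set0.
  move=> ij; apply/seteqP; split=> // t [/E_uniq Ei /Ei ji].
  by rewrite ji ltnn in ij.
(* The default point [(0, 0)] lies in the torus domain, so the bound by [B] also holds for empty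
   cells. *)
pose c i := f (xget (0, 0) (E i)).
have cB i : cabs (c i) <= B.
  by apply: fB; case: xgetP => [t _ []|].
pose h t := \sum_(i < P * P) c i * (\1_(E i) t)%:C.
have hf t : D t -> cabs (f t - h t) <= 2 * e.
  move=> Dt.
  have [p pP tp] := ex_slab (Re \o f) t (le_trans (Re_le_cabs _) (fB t Dt)).
  have [q qP tq] := ex_slab (Im \o f) t (le_trans (Im_le_cabs _) (fB t Dt)).
  have ltn : (p * P + q < P * P)%N.
    by apply: (@leq_trans (p.+1 * P)); rewrite ?leq_mul2r ?pP ?orbT // mulSn; lia.
  have Et : E (p * P + q)%N t.
    by split=> //; rewrite divnMDl // modnMDl divn_small // modn_small // addn0.
  have -> : h t = c (p * P + q)%N.
    rewrite /h (bigD1 (Ordinal ltn)) //= big1 ?addr0.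
      by rewrite indicE mem_set // mulr1.
    move=> i /eqP ni; rewrite indicE memNset ?mulr0 //.
    by move=> Ei; apply: ni; apply/val_inj/(E_uniq _ _ _ Ei Et).
  apply: le_trans (cabs_le_ReIm _) _; rewrite mulr2n mulrDl mul1r /c.
  case: (xgetPex (0, 0) (ex_intro _ t Et)) => _ [b1 b2].
  case: Et => _ [a1 a2]; rewrite !raddfB /=; apply: lerD.
    exact: slab_close a1 b1.
  exact: slab_close a2 b2.
have mh i : cbounded_measurable (fun t => c i * (\1_(E i) t)%:C).
  by apply/cbounded_measurableZ/cbounded_measurable_indic; case: (mE i).
have mh' : cbounded_measurable h by exact: cbounded_measurable_sum.
have hE : cint mu h = \sum_(i < P * P) c i * cm_val mu (E i).
  rewrite cint_sum //; apply: eq_bigr => i _.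
  case: (mE i) => mEi EiD; rewrite cintZ ?cint_indic //.
  exact: cbounded_measurable_indic.
have mN : cbounded_measurable (fun t => (-1) * h t).
  exact: cbounded_measurableZ.
have -> : cint mu f = cint mu h + cint mu (fun t => f t + (-1) * h t).
  by rewrite cintD // cintZ // mulN1r addrC subrK.
apply: le_trans (cabsD _ _) _; apply: lerD.
  rewrite hE; apply: le_trans (cabs_sum _ _ _) _.
  apply: le_trans (ler_wpM2l B0 (sum_cm_val_le (P * P) muW mE dE)).
  rewrite mulr_sumr; apply: ler_sum => i _.
  by rewrite cabsM ler_wpM2r // cabs_ge0.
apply: cabs_cint_crude; first exact: cbounded_measurableD.
by move=> t Dt; rewrite mulN1r hf.
Qed.

Lemma cabs_cint_le mu f (B W : R) : cbounded_measurable f ->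
  (forall t, D t -> cabs (f t) <= B) -> cm_norm mu = W%:E ->
  cabs (cint mu f) <= B * W.
Proof.
move=> mf fB muW; apply/ler_addgt0Pr => e e0.
have m0 : 0 < 4 * cmass mu + 1 by have := cmass_ge0 mu; lra.
have := cabs_cint_approx mf fB muW (divr_gt0 e0 m0).
move/le_trans; apply; rewrite lerD2l.
have -> : 2 * (2 * (e / (4 * cmass mu + 1))) * cmass mu =
  e * (4 * cmass mu / (4 * cmass mu + 1)) by ring.
by rewrite ler_piMr ?ltW // ltr_pdivrMr // mul1r ltrDl.
Qed.

Lemma bounded_measurable_trig (m n : int) (g : R -> R) :
  measurable_fun setT g -> (forall x, `|g x| <= 1) ->
  bounded_measurable (fun t => g (phase m n t)).
Proof.
move=> mg g1; split; last by exists 1.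
apply: measurableT_comp => //; apply: measurable_funM => //.
by apply: measurable_funD; apply: measurable_funM.
Qed.

Lemma cbounded_measurable_expi (m n : int) :
  cbounded_measurable (fun t : R * R => expi (- phase m n t)).
Proof.
split.
  apply: (@bounded_measurable_trig m n (fun x => cos (- x))).
    by apply: measurableT_comp => //; exact: continuous_measurable_fun (@continuous_cos R).
  by move=> x; rewrite ler_norml cos_geN1 cos_le1.
apply: (@bounded_measurable_trig m n (fun x => sin (- x))).
  by apply: measurableT_comp => //; exact: continuous_measurable_fun (@continuous_sin R).
by move=> x; rewrite ler_norml sin_geN1 sin_le1.
Qed.

Lemma fcoefE mu (m n : int) :
  fcoef mu m n = cint mu (fun t => expi (- phase m n t)).
Proof.
have pos (nu : {finite_measure set (R * R)%type -> \bar R}) :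
    fcoef_pos nu m n = cint_pos nu (fun t => expi (- phase m n t)).
  rewrite /fcoef_pos /cint_pos; congr (_ +i* _).
    by apply: eq_Rintegral => t _ /=; rewrite cosN.
  rewrite -mulN1r -RintegralZl; last 2 first.
  - exact: measurable_torus_dom.
  - apply/bounded_measurable_integrable; apply: (@bounded_measurable_trig m n sin).
      exact: continuous_measurable_fun (@continuous_sin R).
    by move=> x; rewrite ler_norml sin_geN1 sin_le1.
  by apply: eq_Rintegral => t _ /=; rewrite sinN mulN1r.
by rewrite /fcoef !pos.
Qed.

End TotalVariationBound.

(** * Quadratic forms in Fourier coefficients *)

Section Duality.
Variable R : realType.
Variables (d : nat) (mu : nat -> cmeasure R) (W : nat -> R) (w : nat -> R[i]).
Hypothesis muW : forall j, (j < d)%N -> cm_norm (mu j) = (W j)%:E.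
Implicit Types (s : seq (int * int)).

(** Fourier coefficients of the measure [sum_j w_j mu_j], whose total variation is at most
    [comb_norm]. *)
Definition comb_fcoef (p : int * int) : R[i] :=
  \sum_(j < d) w j * fcoef (mu j) p.1 p.2.

Definition comb_norm : R := \sum_(j < d) cabs (w j) * W j.

(** The sum is the integral of a trigonometric polynomial against the combined measure, hence is
    controlled by its sup norm. *)
Lemma cabs_sum_comb_fcoef s (c : int * int -> R[i]) (B : R) :
  (forall t : R * R,
    cabs (\sum_(p <- s) c p * expi (- phase p.1 p.2 t)) <= B) ->
  cabs (\sum_(p <- s) c p * comb_fcoef p) <= B * comb_norm.
Proof.
move=> cB; pose g (t : R * R) := \sum_(p <- s) c p * expi (- phase p.1 p.2 t).
have mg p : cbounded_measurable (fun t : R * R => c p * expi (- phase p.1 p.2 t)).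
  exact/cbounded_measurableZ/cbounded_measurable_expi.
have -> : \sum_(p <- s) c p * comb_fcoef p = \sum_(j < d) w j * cint (mu j) g.
  under eq_bigr do rewrite mulr_sumr.
  rewrite exchange_big; apply: eq_bigr => j _.
  rewrite cint_sum // mulr_sumr; apply: eq_bigr => p _.
  rewrite cintZ ?fcoefE 1?mulrCA //; exact: cbounded_measurable_expi.
apply: le_trans (cabs_sum _ _ _) _; rewrite /comb_norm mulr_sumr.
apply: ler_sum => j _; rewrite cabsM mulrCA ler_wpM2l ?cabs_ge0 //.
apply: (cabs_cint_le _ _ (muW (ltn_ord j))).
  exact: (cbounded_measurable_sum s mg).
by move=> t _; exact: cB.
Qed.

(* Applied twice, once per factor of [|f|^2 = f f^*], the previous bound leaves
   only the kernel with Fourier coefficients [c] to be estimated. *)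
Lemma quadratic_form_le s (c : int * int -> R) (B : R) :
  (forall x y : R,
    cabs (\sum_(p <- s) (c p)%:C * expi (p.1%:~R * x + p.2%:~R * y)) <= B) ->
  \sum_(p <- s) c p * cabs (comb_fcoef p) ^+ 2 <= B * comb_norm ^+ 2.
Proof.
move=> cB; apply: le_trans (ler_norm _) _; rewrite -cabs_real.
have -> : (\sum_(p <- s) c p * cabs (comb_fcoef p) ^+ 2)%:C =
    \sum_(p <- s) ((c p)%:C * (comb_fcoef p)^*) * comb_fcoef p.
  rewrite rmorph_sum /=; apply: eq_bigr => p _.
  by rewrite rmorphM /= sqr_cabs -mulrA [X in _ * X]mulrC.
rewrite expr2 mulrA; apply: cabs_sum_comb_fcoef => t; rewrite -cabs_conj.
have -> : (\sum_(p <- s) (c p)%:C * (comb_fcoef p)^* *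
     expi (- phase p.1 p.2 t))^* =
    \sum_(p <- s) ((c p)%:C * expi (phase p.1 p.2 t)) * comb_fcoef p.
  rewrite rmorph_sum; apply: eq_bigr => p _.
  rewrite expiN; case: (comb_fcoef p) (expi _) => a b [a' b'].
  by apply/eqP; rewrite eq_complex /=; apply/andP; split; apply/eqP; ring.
apply: cabs_sum_comb_fcoef => t'.
(* The two integrations leave the kernel evaluated at the difference [t - t']. *)
apply: le_trans (cB (2 * pi * (t.1 - t'.1)) (2 * pi * (t.2 - t'.2))).
rewrite le_eqVlt; apply/orP; left; apply/eqP; congr cabs.
apply: eq_bigr => p _; rewrite -mulrA -expiD; congr (_ * expi _).
by rewrite /phase; ring.
Qed.

End Duality.

(** * Uniform densities on frequency rectangles and their transforms *)

Section FrequencyBoxes.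
Variable R : realType.

Definition zrange (B : nat) : seq int := [seq i%:Z - B%:Z | i <- iota 0 (2 * B)].

Lemma mem_zrange B (m : int) : (m \in zrange B) = (- B%:Z <= m < B%:Z).
Proof.
apply/mapP/idP => [[j]|mB]; first by rewrite mem_iota => ? ->; lia.
exists (absz (m + B%:Z)); last by lia.
by rewrite mem_iota; lia.
Qed.

Lemma zrange_uniq B : uniq (zrange B).
Proof. by rewrite map_inj_uniq ?iota_uniq // => i j; lia. Qed.

Definition zbox (B : nat) : seq (int * int) :=
  [seq (m, n) | m <- zrange B, n <- zrange B].

Lemma zbox_uniq B : uniq (zbox B).
Proof. by apply: allpairs_uniq; rewrite ?zrange_uniq // => -[? ?] []. Qed.

Lemma mem_zbox B p :
  (p \in zbox B) = (- B%:Z <= p.1 < B%:Z) && (- B%:Z <= p.2 < B%:Z).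
Proof.
case: p => m n; rewrite -!mem_zrange; apply/allpairsP/andP => /=.
  by case=> -[a b] [/= ? ? [-> ->]].
by case=> mB nB; exists (m, n).
Qed.

Definition interval_density (M : int) (L : nat) (m : int) : R :=
  if M <= m < M + L%:Z then L%:R^-1 else 0.

Lemma sum_interval_density (B : nat) (M : int) (L : nat) (x : R) :
  - B%:Z <= M -> M + L%:Z <= B%:Z ->
  \sum_(m <- zrange B) (interval_density M L m)%:C * expi (m%:~R * x) =
  interval_mean M L x.
Proof.
move=> BM MB.
have -> : \sum_(m <- zrange B) (interval_density M L m)%:C * expi (m%:~R * x) =
    \sum_(m <- zrange B | M <= m < M + L%:Z) (L%:R^-1)%:C * expi (m%:~R * x).
  rewrite [RHS]big_mkcond; apply: eq_bigr => m _; rewrite /interval_density.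
  by case: ifP; rewrite ?mul0r.
rewrite -big_filter -mulr_sumr; congr (_ * _).
rewrite -(big_mkord predT (fun j => expi ((M + j%:Z)%:~R * x))).
rewrite -(big_map (fun j : nat => M + j%:Z) predT (fun m => expi (m%:~R * x))).
apply: perm_big; apply: uniq_perm.
- by rewrite filter_uniq // zrange_uniq.
- by rewrite map_inj_uniq ?iota_uniq // => i j; lia.
move=> m; rewrite mem_filter mem_zrange; apply/idP/mapP => [mM|[j]].
  exists (absz (m - M)); last by lia.
  by rewrite mem_iota; lia.
by rewrite mem_iota => ? ->; lia.
Qed.

Definition rect_density (M : int) (L : nat) (M' : int) (L' : nat)
  (p : int * int) : R := interval_density M L p.1 * interval_density M' L' p.2.

Lemma sum_rect_density (B : nat) (M M' : int) (L L' : nat) (x y : R) :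
  - B%:Z <= M -> M + L%:Z <= B%:Z -> - B%:Z <= M' -> M' + L'%:Z <= B%:Z ->
  \sum_(p <- zbox B)
    (rect_density M L M' L' p)%:C * expi (p.1%:~R * x + p.2%:~R * y) =
  interval_mean M L x * interval_mean M' L' y.
Proof.
move=> BM MB BM' MB'; rewrite big_allpairs.
rewrite -(sum_interval_density x BM MB) -(sum_interval_density y BM' MB').
rewrite mulr_suml; apply: eq_bigr => m _; rewrite mulr_sumr.
by apply: eq_bigr => n _; rewrite rmorphM expiD mulrACA.
Qed.

End FrequencyBoxes.

(** * Summation over scales *)

Section ScaleSum.
Variable R : realType.

(* The case distinction is the potential of the induction: below scale 1 the sum
   is at most [g T], above it at most [4 - 2 / g T]. *)
Lemma sum_scale_le (C : R) (g d : nat -> R) (T : nat) : (0 < T)%N -> 0 <= C ->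
  (forall t, 0 <= g t) -> (forall t, 0 <= d t) ->
  (forall t, (0 < t)%N -> d t <= C * g t) ->
  (forall t, (0 < t)%N -> g t * d t <= C) ->
  (forall t, (0 < t)%N -> g t * t.+1%:R <= g t.+1 * t%:R) ->
  \sum_(1 <= t < T) d t / t%:R <= 4 * C.
Proof.
move=> T0 C0 g0 d0 dg gd gS.
have gi t : (0 < t)%N -> g t <= g t.+1.
  move=> t0; rewrite -(@ler_pM2r _ t%:R) ?ltr0n //.
  by apply: le_trans (gS t t0); rewrite ler_wpM2l // ler_nat.
suff : \sum_(1 <= t < T) d t / t%:R <=
    C * (if g T < 1 then g T else 4 - 2 / g T).
  move/le_trans; apply; rewrite mulrC ler_wpM2r //; case: ltrP => [|gT].
    by move=> /ltW /le_trans; apply; rewrite ler1n.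
  by rewrite gerBl divr_ge0.
case: T T0 => // T _; elim: T => [|T IH].
  rewrite big_geq // mulr_ge0 //; case: ltrP => // g1.
  by rewrite subr_ge0 ler_pdivrMr; lra.
rewrite big_nat_recr //=; apply: le_trans (lerD IH (lexx _)) _.
have T0 : 0 < T.+1%:R :> R by rewrite ltr0n.
have T1 : 1 <= T.+1%:R :> R by rewrite ler1n.
have := gS T.+1 isT; have := gi T.+1 isT; have := dg T.+1 isT.
have := gd T.+1 isT; have := g0 T.+1; have := d0 T.+1.
have -> : T.+2%:R = T.+1%:R + 1 :> R by rewrite -natr1.
move: (g T.+1) (g T.+2) (d T.+1) T0 T1; set r : R := T.+1%:R; clearbody r.
move=> x x' e r0 r1 e0 x0 xe ex xx' xr.
have rV0 : 0 < r^-1 by rewrite invr_gt0.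
have rV1 : r^-1 <= 1 by rewrite invf_le1.
(* Below scale 1 the new term, at most [C x / r], is paid by the growth [x' - x >= x / r]. If [x']
   crosses 1, the sum is at most [2 C], and [2 <= 4 - 2 / x']. *)
have [x1|x1] := ltrP x 1.
  have le1 : C * x + e / r <= C * (x * (1 + r^-1)).
    by rewrite mulrDr mulr1 mulrDr lerD2l mulrA ler_pM2r ?invr_gt0.
  apply: le_trans le1 _; rewrite ler_wpM2l //; case: ltrP => x'1.
    rewrite -(ler_pM2r r0) -mulrA mulrDl mul1r mulVf ?gt_eqF //.
  have : x * (1 + r^-1) <= 1 * 2.
    by apply: ler_pM; lra.
  have : 2 / x' <= 2 by rewrite ler_pdivrMr; lra.
  lra.
have x'1 : 1 <= x' by lra.
have xp : 0 < x by lra.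
have x'p : 0 < x' by lra.
rewrite ltNge x'1 /=.
(* Above scale 1 the new term is at most [C / (x r)], while [2 / x - 2 / x' >= 1 / (x r)] because
   [r / (r + 1) <= 1 - 1 / (2 r)] for [r >= 1]. *)
have le1 : e / r <= C * (x^-1 / r).
  by rewrite mulrA ler_pM2r ?invr_gt0 // ler_pdivlMr // mulrC.
apply: le_trans (lerD (lexx _) le1) _; rewrite -mulrDr ler_wpM2l //.
have x'V : x'^-1 <= x^-1 * (r / (r + 1)).
  rewrite -lef_pV2 ?posrE ?invr_gt0 ?mulr_gt0 ?invr_gt0 ?divr_gt0 //; try lra.
  by rewrite invfM !invrK invf_div mulrA ler_pdivrMr.
have : r / (r + 1) <= 1 - r^-1 / 2.
  rewrite ler_pdivrMr; last by lra.
  have -> : (1 - r^-1 / 2) * (r + 1) = r + (1 / 2 - r^-1 / 2) by field; rewrite gt_eqF.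
  lra.
move=> rr; have : x^-1 * (r / (r + 1)) <= x^-1 * (1 - r^-1 / 2).
  by rewrite ler_pM2l ?invr_gt0.
move: x'V; set a := x^-1 * (r / (r + 1)).
have -> : x^-1 * (1 - r^-1 / 2) = x^-1 - (x^-1 / r) / 2 by ring.
move=> h1 h2; lra.
Qed.

End ScaleSum.

(** * The two families of boxes *)

Lemma leq_expl e s t : (s <= t)%N -> (s ^ e <= t ^ e)%N.
Proof. by case: e => // e st; rewrite leq_exp2r. Qed.

Section Kernel.
Variable R : realType.

(** Both means are close to 1 near the origin, with Lipschitz constants [3 p X] and [(q + 1) X]. The
    constant is rounded up to serve also for the decay estimate, where [2 + 2] is needed. *)
Lemma interval_mean_sub_le (p q X : nat) (x : R) : (0 < p)%N -> (0 < X)%N ->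
  cabs (interval_mean (- (p * X)%:Z) (2 * p * X) x -
        interval_mean (q * X)%:Z X x) <=
    (3 * p + q + 4)%:R * (X%:R * cabs (expi x - 1)).
Proof.
move=> p0 X0; have X0' : (0 < 2 * p * X)%N by rewrite !muln_gt0 p0 X0.
have -> : interval_mean (- (p * X)%:Z) (2 * p * X) x -
    interval_mean (q * X)%:Z X x =
    (interval_mean (- (p * X)%:Z) (2 * p * X) x - 1) -
    (interval_mean (q * X)%:Z X x - 1) by ring.
apply: le_trans (cabsB _ _) _.
apply: le_trans (lerD (cabs_interval_mean_sub1 _ _ X0')
  (cabs_interval_mean_sub1 _ _ X0)) _.
rewrite -mulrDl mulrA -natrD -natrM ler_wpM2r ?cabs_ge0 // ler_nat.
by rewrite abszN !absz_nat; nia.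
Qed.

Lemma interval_mean_sub_decay (p q X : nat) (x : R) : (0 < p)%N ->
  X%:R * cabs (expi x - 1) *
    cabs (interval_mean (- (p * X)%:Z) (2 * p * X) x -
          interval_mean (q * X)%:Z X x) <= (3 * p + q + 4)%:R.
Proof.
move=> p0; have g0 : 0 <= X%:R * cabs (expi x - 1) by rewrite mulr_ge0 ?cabs_ge0.
apply: le_trans (ler_wpM2l g0 (cabsB _ _)) _; rewrite mulrDr.
have le1 : X%:R * cabs (expi x - 1) *
    cabs (interval_mean (- (p * X)%:Z) (2 * p * X) x) <= 2.
  apply: le_trans (cabs_interval_mean_decay (- (p * X)%:Z) (2 * p * X) x).
  rewrite ler_wpM2r ?cabs_ge0 // ler_wpM2r ?cabs_ge0 // ler_nat; nia.
apply: le_trans (lerD le1 (cabs_interval_mean_decay _ _ _)) _.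
by rewrite -natrD ler_nat; lia.
Qed.

Variables (A Q k l : nat).
Hypotheses (A0 : (0 < A)%N) (Q1 : (1 < Q)%N) (k0 : (0 < k)%N) (l0 : (0 < l)%N).

Let Q0 : (0 < Q)%N := ltnW Q1.

(** Chosen so that [A * side e t = (A * t) ^ e] for [e > 0]: box corners are multiples of perfect
    powers, and the side is the fraction [1 / A] of that power. *)
Definition side (e t : nat) : nat := (A ^ e.-1 * t ^ e)%N.

Lemma side_gt0 e t : (0 < t)%N -> (0 < side e t)%N.
Proof. by move=> t0; rewrite muln_gt0 !expn_gt0 A0 t0. Qed.

Lemma leq_side e s t : (s <= t)%N -> (side e s <= side e t)%N.
Proof. by move=> st; rewrite leq_mul2l leq_expl ?orbT. Qed.

Definition big_box (t : nat) : int * int -> R :=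
  rect_density R (- (Q * A * side l t)%:Z) (2 * (Q * A) * side l t)
                 (- (Q * A * side k t)%:Z) (2 * (Q * A) * side k t).

Definition small_box (a t : nat) : int * int -> R :=
  rect_density R (a * A * side l t)%:Z (side l t) (A * side k t)%:Z (side k t).

(** The big boxes run up to [2 * T] so that for each scale [s < T] the whole dyadic block [[s, 2 s)]
    is available. Starting at [A] ensures [1 <= s / A] when the scales seeing a frequency are
    counted. *)
Definition form_weight (a T : nat) (p : int * int) : R :=
  \sum_(A <= t < 2 * T) t%:R^-1 * big_box t p -
  \sum_(A <= t < T) t%:R^-1 * small_box a t p.

(** One term [4 * (4 Q A + 4)] per coordinate, and 1 for the unmatched big boxes at scales in
    [[T, 2 T)]. *)
Definition kernel_bound : R := 8 * (4 * Q * A + 4)%:R + 1.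

(** The variable at scale [t] is [g = side e t * |e^{ix} - 1|]: the difference of the means is
    [O(g)] and [O(1 / g)], and [g / t] is nondecreasing, as [sum_scale_le] demands. *)
Lemma sum_mean_diff_le (e q T : nat) (x : R) : (0 < T)%N -> (0 < e)%N ->
  (q <= Q * A)%N ->
  \sum_(A <= t < T) t%:R^-1 *
     cabs (interval_mean (- (Q * A * side e t)%:Z) (2 * (Q * A) * side e t) x -
           interval_mean (q * side e t)%:Z (side e t) x) <=
  4 * (4 * Q * A + 4)%:R.
Proof.
move=> T0 e0 qQ; pose g t : R := (side e t)%:R * cabs (expi x - 1).
pose d t := cabs (interval_mean (- (Q * A * side e t)%:Z) (2 * (Q * A) * side e t) x -
           interval_mean (q * side e t)%:Z (side e t) x).
have QA0 : (0 < Q * A)%N by rewrite muln_gt0 Q0 A0.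
have cst : (3 * (Q * A) + q + 4)%:R <= (4 * Q * A + 4)%:R :> R.
  by rewrite ler_nat; lia.
apply: (@le_trans _ _ (\sum_(1 <= t < T) d t / t%:R)).
  have [AT|TA] := leqP A T; last first.
    rewrite big_geq ?(ltnW TA) //.
    by apply: sumr_ge0 => t _; rewrite divr_ge0 ?cabs_ge0.
  rewrite [leRHS](big_cat_nat (n := A)) //=.
  rewrite -[leLHS]add0r; apply: lerD.
    by apply: sumr_ge0 => t _; rewrite divr_ge0 ?cabs_ge0.
  by apply: ler_sum => t _; rewrite mulrC.
apply: (@sum_scale_le _ _ g d) => //.
- by move=> t; rewrite mulr_ge0 ?cabs_ge0.
- by move=> t; rewrite cabs_ge0.
- move=> t t0; apply: le_trans (interval_mean_sub_le _ _ QA0 (side_gt0 e t0)) _.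
  by rewrite ler_wpM2r // mulr_ge0 ?cabs_ge0.
- by move=> t t0; apply: le_trans (interval_mean_sub_decay _ _ _ QA0) _.
move=> t t0; rewrite /g mulrAC [leRHS]mulrAC ler_wpM2r ?cabs_ge0 //.
rewrite -!natrM ler_nat /side -!mulnA leq_mul2l; apply/orP; right.
rewrite -(prednK e0) !expnSr -!mulnA [(t.+1 * t)%N]mulnC.
by rewrite leq_mul2r leq_expl ?orbT.
Qed.

Lemma sum_inv_le1 T : \sum_(T <= t < 2 * T) t%:R^-1 <= 1 :> R.
Proof.
case: T => [|T]; first by rewrite big_geq.
apply: (@le_trans _ _ (\sum_(T.+1 <= t < 2 * T.+1) T.+1%:R^-1)).
  rewrite big_nat_cond [leRHS]big_nat_cond; apply: ler_sum => t /andP[/andP[Tt _] _].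
  by rewrite lef_pV2 ?posrE ?ltr0n ?ler_nat //; lia.
rewrite sumr_const_nat -[_ *+ _]mulr_natr mul2n -addnn addnK.
by rewrite mulVf ?pnatr_eq0.
Qed.

Lemma cabs_kernel_le (a T B : nat) (x y : R) : (a < Q)%N -> (A <= T)%N ->
  (Q * A * side l (2 * T) <= B)%N -> (Q * A * side k (2 * T) <= B)%N ->
  cabs (\sum_(p <- zbox B)
    (form_weight a T p)%:C * expi (p.1%:~R * x + p.2%:~R * y)) <= kernel_bound.
Proof.
move=> aQ AT Bl Bk.
pose F e t z := interval_mean (- (Q * A * side e t)%:Z) (2 * (Q * A) * side e t) z : R[i].
pose G e q t z := interval_mean (q * side e t)%:Z (side e t) z : R[i].
have F1 e t z : cabs (F e t z) <= 1 by exact: cabs_interval_mean_le1.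
have G1 e q t z : cabs (G e q t z) <= 1 by exact: cabs_interval_mean_le1.
have QA0 : (0 < Q * A)%N by rewrite muln_gt0 Q0 A0.
have aA : ((a * A).+1 <= Q * A)%N by nia.
have A1 : (A.+1 <= Q * A)%N by nia.
have -> : \sum_(p <- zbox B)
    (form_weight a T p)%:C * expi (p.1%:~R * x + p.2%:~R * y) =
    \sum_(A <= t < 2 * T) (t%:R^-1)%:C * (F l t x * F k t y) -
    \sum_(A <= t < T) (t%:R^-1)%:C * (G l (a * A)%N t x * G k A t y).
  rewrite /form_weight.
  transitivity (\sum_(p <- zbox B) (\sum_(A <= t < 2 * T)
      (t%:R^-1)%:C * ((big_box t p)%:C * expi (p.1%:~R * x + p.2%:~R * y)) -
      \sum_(A <= t < T) (t%:R^-1)%:C *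
        ((small_box a t p)%:C * expi (p.1%:~R * x + p.2%:~R * y)))).
    apply: eq_bigr => p _; rewrite rmorphB !rmorph_sum mulrBl !mulr_suml.
    by congr (_ - _); apply: eq_bigr => t _; rewrite rmorphM mulrA.
  rewrite sumrB; congr (_ - _); rewrite exchange_big big_nat_cond [RHS]big_nat_cond;
    apply: eq_bigr => t /andP[/andP[At tT] _]; rewrite -mulr_sumr; congr (_ * _).
    have sl := @leq_side l t (2 * T) (ltnW tT).
    have sk := @leq_side k t (2 * T) (ltnW tT).
    apply: sum_rect_density; nia.
  have tT2 : (t <= 2 * T)%N by lia.
  have sl := @leq_side l t (2 * T) tT2.
  have sk := @leq_side k t (2 * T) tT2.
  apply: sum_rect_density; nia.
rewrite (big_cat_nat (n := T)) //=; last by lia.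
rewrite addrAC -sumrB; apply: le_trans (cabsD _ _) _; apply: lerD; last first.
  apply: le_trans (cabs_sum _ _ _) _; apply: le_trans (sum_inv_le1 T).
  apply: ler_sum => t _; rewrite cabsM (cabsM (F l t x)) cabs_real ger0_norm ?invr_ge0 //.
  by apply: ler_piMr; [rewrite invr_ge0|apply: mulr_ile1; rewrite ?cabs_ge0 ?F1].
have T0 : (0 < T)%N by lia.
have hl := @sum_mean_diff_le l (a * A) T x T0 l0 (ltnW aA).
have hk := @sum_mean_diff_le k A T y T0 k0 (ltnW A1).
apply: (@le_trans _ _ (4 * (4 * Q * A + 4)%:R + 4 * (4 * Q * A + 4)%:R)).
  apply: le_trans (lerD hl hk); apply: le_trans (cabs_sum _ _ _) _.
  rewrite -big_split /=; apply: ler_sum => t _.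
  rewrite -mulrBr cabsM cabs_real ger0_norm ?invr_ge0 // -mulrDr.
  rewrite ler_wpM2l ?invr_ge0 //.
  have -> : F l t x * F k t y - G l (a * A)%N t x * G k A t y =
    (F l t x - G l (a * A)%N t x) * F k t y +
    G l (a * A)%N t x * (F k t y - G k A t y) by ring.
  apply: le_trans (cabsD _ _) _; rewrite (cabsM _ (F k t y)) (cabsM (G l _ t x)).
  apply: lerD.
    by rewrite ler_piMr ?cabs_ge0.
  by rewrite ler_piMl ?cabs_ge0.
by rewrite -mulrDl -natrD.
Qed.

End Kernel.

(** * Total densities of the big and the small boxes at a frequency *)

Section WeightComparison.
Variable R : realType.
Variables (A Q k l : nat).
Hypotheses (A0 : (0 < A)%N) (Q1 : (1 < Q)%N) (k0 : (0 < k)%N).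
Let Q0 : (0 < Q)%N := ltnW Q1.
Local Notation X := (side A l).
Local Notation Y := (side A k).

Definition in_big_box (s : nat) (p : int * int) :=
  (- (Q * A * X s)%:Z <= p.1 < (Q * A * X s)%:Z) &&
  (- (Q * A * Y s)%:Z <= p.2 < (Q * A * Y s)%:Z).

Definition in_small_box (a s : nat) (p : int * int) :=
  ((a * A * X s)%:Z <= p.1 < (a * A * X s)%:Z + (X s)%:Z) &&
  ((A * Y s)%:Z <= p.2 < (A * Y s)%:Z + (Y s)%:Z).

Definition big_sum T p : R := \sum_(A <= t < 2 * T) t%:R^-1 * big_box R A Q k l t p.

Definition small_sum a T p : R := \sum_(A <= t < T) t%:R^-1 * small_box R A k l a t p.

Lemma interval_density_ge0 M L m : 0 <= interval_density R M L m.
Proof. by rewrite /interval_density; case: ifP; rewrite ?invr_ge0. Qed.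

Lemma rect_density_ge0 M L M' L' p : 0 <= rect_density R M L M' L' p.
Proof. by rewrite mulr_ge0 ?interval_density_ge0. Qed.

Lemma big_sum_ge0 T p : 0 <= big_sum T p.
Proof.
by apply: sumr_ge0 => t _; rewrite mulr_ge0 ?invr_ge0 ?rect_density_ge0.
Qed.

Lemma big_boxE t p : in_big_box t p ->
  big_box R A Q k l t p = ((4 * (Q * A) ^ 2 * (X t * Y t))%N%:R)^-1.
Proof.
move=> /andP[h1 h2]; rewrite /big_box /rect_density /interval_density.
rewrite !ifT; first by rewrite -invfM -natrM; congr (_%:R^-1); ring.
  by move: h2; lia.
by move: h1; lia.
Qed.

Lemma small_boxE a t p :
  small_box R A k l a t p =
  if in_small_box a t p then ((X t * Y t)%N%:R)^-1 else 0.
Proof.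
rewrite /small_box /rect_density /interval_density /in_small_box.
by do 2 case: ifP => _; rewrite ?mulr0 ?mul0r //= natrM invfM.
Qed.

(** A big box has [4 (Q A)^2 X Y] points, [X Y] grows by at most [2^(l + k)] over a dyadic block,
    and the last factor 2 comes from [s] weights of size at least [1 / (2 s)]. *)
Definition big_cst : nat := (8 * (Q * A) ^ 2 * 2 ^ (l + k))%N.

Lemma in_big_box_mono s t p : (s <= t)%N -> in_big_box s p -> in_big_box t p.
Proof.
move=> st; have := @leq_side A l _ _ st; have := @leq_side A k _ _ st.
have QA0 : (0 < Q * A)%N by rewrite muln_gt0 Q0 A0.
rewrite -(leq_pmul2l QA0) -[(X s <= _)%N](leq_pmul2l QA0) /in_big_box.
by move=> ? ? /andP[? ?]; apply/andP; split; lia.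
Qed.

Lemma side_double e s t : (t <= 2 * s)%N -> (side A e t <= 2 ^ e * side A e s)%N.
Proof.
move=> ts; apply: leq_trans (leq_side A e ts) _.
by rewrite /side expnMn mulnCA.
Qed.

(** Big boxes increase with the scale, so every scale in [[s, 2 s)] sees [p]. *)
Lemma big_sum_ge s T p : (A <= s)%N -> (s < T)%N -> in_big_box s p ->
  ((big_cst * (X s * Y s))%N%:R)^-1 <= big_sum T p.
Proof.
move=> As sT sp; have s0 : (0 < s)%N by lia.
have X0 := side_gt0 A0 l s0; have Y0 := side_gt0 A0 k s0.
have QA0 : (0 < Q * A)%N by rewrite muln_gt0 Q0 A0.
pose c : R := ((4 * (Q * A) ^ 2 * (2 ^ (l + k) * (X s * Y s)))%N%:R)^-1.
have term t : (s <= t < 2 * s)%N ->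
    ((2 * s)%N%:R)^-1 * c <= t%:R^-1 * big_box R A Q k l t p.
  move=> /andP[st ts]; rewrite big_boxE; last exact: in_big_box_mono sp.
  have t0 : (0 < t)%N by lia.
  have Xt := side_gt0 A0 l t0; have Yt := side_gt0 A0 k t0.
  have hX := @side_double l s t (ltnW ts); have hY := @side_double k s t (ltnW ts).
  rewrite ler_pM ?invr_ge0 //.
    by rewrite lef_pV2 ?posrE ?ltr0n ?ler_nat //; lia.
  rewrite lef_pV2 ?posrE ?ltr0n ?ler_nat ?muln_gt0 ?expn_gt0 ?A0 ?Q0 ?s0 ?t0 //.
  rewrite leq_mul2l; apply/orP; right.
  by rewrite expnD mulnACA leq_mul.
have -> : ((big_cst * (X s * Y s))%N%:R)^-1 =
    \sum_(s <= t < 2 * s) ((2 * s)%N%:R)^-1 * c :> R.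
  rewrite sumr_const_nat mul2n -addnn addnK /c -invfM -natrM -[RHS]mulr_natr.
  have -> : ((s + s) * (4 * (Q * A) ^ 2 * (2 ^ (l + k) * (X s * Y s))) =
      big_cst * (X s * Y s) * s)%N by rewrite /big_cst; ring.
  by rewrite [in RHS]natrM [in RHS]invfM mulfVK // pnatr_eq0; lia.
have [s2 s2T sT2] : [/\ s <= 2 * s, 2 * s <= 2 * T & s <= 2 * T]%N by split; lia.
rewrite /big_sum (big_cat_nat As sT2) (big_cat_nat s2 s2T) /=.
rewrite addrCA ler_wpDr //; last first.
  rewrite big_nat_cond [leRHS]big_nat_cond; apply: ler_sum => t /andP[h _].
  exact: term.
by rewrite addr_ge0 // sumr_ge0 // => t _;
  rewrite mulr_ge0 ?invr_ge0 ?rect_density_ge0.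
Qed.

Lemma sum_window_le (c : R) (a b s r : nat) : 0 <= c ->
  \sum_(a <= t < b) (if (s <= t < s + r)%N then c else 0) <= c * r%:R.
Proof.
move=> c0; rewrite -big_mkcond big_const_seq iter_addr_0 -size_filter.
rewrite -[leLHS]mulr_natr ler_wpM2l // ler_nat -[leqRHS](size_iota s).
apply: uniq_leq_size; first by rewrite filter_uniq // iota_uniq.
by move=> t; rewrite mem_filter mem_iota => /andP[].
Qed.

(* At most [1 + s / A] scales see a given frequency, [s] being the first one. *)
Lemma small_sum_le a T p : small_sum a T p = 0 \/
  exists s, [/\ (A <= s < T)%N, in_small_box a s p &
    small_sum a T p <= 2 / A%:R * ((X s * Y s)%N%:R)^-1].
Proof.
pose P t := (A <= t < T)%N && in_small_box a t p.
case: (pselect (exists t, P t)) => [exP|nP]; [right|left]; last first.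
  rewrite /small_sum big_nat_cond big1 // => t /andP[tT _].
  by rewrite small_boxE; case: ifP; rewrite ?mulr0 // => tp; case: nP;
    exists t; rewrite /P tT.
have [s /andP[sT sp] smin] := ex_minnP exP; exists s; split=> //.
have s0 : (0 < s)%N by lia.
have X0 := side_gt0 A0 l s0; have Y0 := side_gt0 A0 k s0.
pose c : R := s%:R^-1 * ((X s * Y s)%N%:R)^-1.
have c0 : 0 <= c by rewrite mulr_ge0 ?invr_ge0.
apply: (@le_trans _ _ (c * (s %/ A).+1%:R)).
  apply: le_trans (sum_window_le A T s (s %/ A).+1 c0).
  rewrite /small_sum big_nat_cond [leRHS]big_nat_cond.
  apply: ler_sum => t /andP[tT _]; rewrite small_boxE; case: ifP => tp; last first.
    by rewrite mulr0; case: ifP.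
  have st : (s <= t)%N by apply: smin; rewrite /P tT.
  have t0 : (0 < t)%N by lia.
  (* The second coordinate gives [A Y_t <= n < (A + 1) Y_s]; since [Y_t / t] is nondecreasing in
     [t], this passes to [t] and [s]. *)
  have Ats : (A * t < A.+1 * s)%N.
    have h : (A * Y t < A.+1 * Y s)%N.
      by move: tp sp => /andP[_ h1] /andP[_ h2]; rewrite mulSn; lia.
    rewrite ltnNge; apply/negP => h'; move: h; rewrite ltnNge => /negP; apply.
    have E r v : (r * Y v = A ^ k.-1 * (r * v * v ^ k.-1))%N.
      by rewrite /side -{2}(prednK k0) expnS; ring.
    by rewrite !E leq_mul2l leq_mul ?orbT // leq_expl.
  rewrite ifT; last first.
    rewrite st /= addnS ltnS -leq_subLR leq_divRL //.
    by move: Ats; rewrite mulSn mulnBl ![(_ * A)%N]mulnC; lia.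
  have Xt := side_gt0 A0 l t0; have Yt := side_gt0 A0 k t0.
  rewrite ler_pM ?invr_ge0 //.
    by rewrite lef_pV2 ?posrE ?ltr0n ?ler_nat.
  rewrite lef_pV2 ?posrE ?ltr0n ?ler_nat ?muln_gt0 ?expn_gt0 ?A0 ?s0 ?t0 //.
  by rewrite leq_mul // leq_side.
(* From [A <= s] follows [s / A + 1 <= 2 s / A]. *)
rewrite /c mulrAC ler_wpM2r ?invr_ge0 // ler_pdivrMl ?ltr0n //.
rewrite mulrA ler_pdivlMr ?ltr0n // -natrM -natrM ler_nat.
by have := leq_trunc_div s A; nia.
Qed.

(** As [a < Q], the small box lies in the big box of the same scale. The scale [s] stays in the
    conclusion because membership in a small box is what makes the node value small. *)
Lemma small_le_big a T p : (a < Q)%N -> small_sum a T p = 0 \/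
  exists s, [/\ (A <= s < T)%N, in_small_box a s p &
    small_sum a T p <= 2 * big_cst%:R / A%:R * big_sum T p].
Proof.
move=> aQ; have [->|[s [sT sp le1]]] := small_sum_le a T p; [by left|right].
exists s; split=> //; apply: le_trans le1 _.
have s0 : (0 < s)%N by lia.
have X0 := side_gt0 A0 l s0; have Y0 := side_gt0 A0 k s0.
have spb : in_big_box s p.
  have h1 : (a * A * X s + X s <= Q * A * X s)%N.
    by rewrite -mulSnr leq_mul2r; apply/orP; right; nia.
  have h2 : (A * Y s + Y s <= Q * A * Y s)%N.
    by rewrite -mulSnr leq_mul2r; apply/orP; right; nia.
  by move: sp => /andP[/andP[? ?] /andP[? ?]]; apply/andP; split; lia.
have /andP[As sT'] := sT; have := big_sum_ge As sT' spb.
move=> h; rewrite -!mulrA ler_wpM2l // [leRHS]mulrCA ler_wpM2l ?invr_ge0 //.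
rewrite -ler_pdivrMl ?ltr0n //; last by rewrite /big_cst !(muln_gt0, expn_gt0) Q0 A0.
by apply: le_trans h; rewrite -invfM -natrM.
Qed.

End WeightComparison.

(** * The system at a single frequency *)

Lemma sqr_sum_le (R : realFieldType) (d : nat) (x : 'I_d -> R) :
  (\sum_i x i) ^+ 2 <= d%:R * \sum_i x i ^+ 2.
Proof.
rewrite expr2 mulr_suml.
apply: (@le_trans _ _ (\sum_i \sum_j (x i ^+ 2 / 2 + x j ^+ 2 / 2))).
  apply: ler_sum => i _; rewrite mulr_sumr; apply: ler_sum => j _.
  by have := sqr_ge0 (x i - x j); rewrite sqrrB; nra.
under eq_bigr do rewrite big_split /= sumr_const card_ord.
rewrite big_split /= sumr_const card_ord sumrMnl -mulr_suml -mulrnDl -splitr.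
by rewrite mulr_natl.
Qed.

Section LinearAlgebra.
Variable R : realType.

(** Distinct nodes make the Vandermonde matrix invertible; [K] comes from the entries of the inverse
    and Cauchy-Schwarz, with summands 1 that keep it positive. *)
Lemma vandermonde_lower_bound (d : nat) (z : 'I_d -> R[i]) : injective z ->
  exists2 K : R, 0 < K & forall u : nat -> R[i],
    (\sum_(j < d) cabs (u j)) ^+ 2 <=
    K * \sum_(i < d) cabs (\sum_(j < d) z i ^+ j * u j) ^+ 2.
Proof.
move=> zinj; pose a : 'rV[R[i]]_d := \row_i z i.
pose V := Vandermonde d a; pose V' := invmx V.
have Vu : V \in unitmx.
  rewrite unitmxE unitfE det_Vandermonde; apply/prodf_neq0 => i _.
  apply/prodf_neq0 => j ij; rewrite !mxE subr_eq0 (inj_eq zinj).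
  by apply: contraTneq ij => ->; rewrite ltnn.
pose M : R := 1 + \sum_i \sum_j cabs (V' i j).
have M0 : 0 < M.
  rewrite ltr_pwDl // sumr_ge0 // => i _; rewrite sumr_ge0 // => j _.
  exact: cabs_ge0.
exists (M ^+ 2 * (d%:R + 1)).
  by rewrite mulr_gt0 ?exprn_gt0 // ltr_wpDl.
move=> u; pose U : 'rV[R[i]]_d := \row_j u j.
pose v i := \sum_(j < d) z i ^+ j * u j.
have UE : U = (U *m V) *m V' by rewrite mulmxK.
have vE i : (U *m V) 0 i = v i.
  by rewrite mxE; apply: eq_bigr => j _; rewrite !mxE mulrC.
have uE (j : 'I_d) : u j = \sum_i v i * V' i j.
  have -> : u j = U 0 j by rewrite mxE.
  by rewrite {1}UE mxE; apply: eq_bigr => i _; rewrite vE.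
have le1 : \sum_(j < d) cabs (u j) <= M * \sum_i cabs (v i).
  apply: (@le_trans _ _ (\sum_(j < d) \sum_i cabs (v i) * cabs (V' i j))).
    apply: ler_sum => j _; rewrite uE; apply: le_trans (cabs_sum _ _ _) _.
    by apply: ler_sum => i _; rewrite cabsM.
  rewrite exchange_big mulr_sumr; apply: ler_sum => i _; rewrite -mulr_sumr mulrC.
  rewrite ler_wpM2r ?cabs_ge0 // /M [X in 1 + X](bigD1 i) //= addrCA.
  rewrite lerDl addr_ge0 // sumr_ge0 // => i' _; rewrite sumr_ge0 // => j _.
  exact: cabs_ge0.
have s0 : 0 <= \sum_(j < d) cabs (u j) by rewrite sumr_ge0 // => j _; exact: cabs_ge0.
have s0' : 0 <= \sum_i cabs (v i) ^+ 2 by rewrite sumr_ge0 // => j _; rewrite sqr_ge0.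
apply: (@le_trans _ _ ((M * \sum_i cabs (v i)) ^+ 2)).
  by rewrite ler_sqr ?nnegrE //; apply: le_trans le1.
rewrite exprMn -mulrA ler_wpM2l ?sqr_ge0 //.
by apply: le_trans (sqr_sum_le _) _; rewrite ler_wpM2r // lerDl.
Qed.

Section Chain.
Variables (a b : R[i]) (psi : nat -> R[i]) (N : nat).
Hypotheses (psi0 : psi 0%N = 0) (psiN : psi N.+1 = 0).
Local Notation u j := (b * psi j - a * psi j.+1).

(** Summation by parts; the boundary terms vanish by [psi0] and [psiN]. *)
Lemma sum_chain (z : R[i]) :
  \sum_(j < N.+1) z ^+ j * u j = (b * z - a) * \sum_(j < N) z ^+ j * psi j.+1.
Proof.
have -> : \sum_(j < N.+1) z ^+ j * u j =
    \sum_(j < N.+1) z ^+ j * (b * psi j) - \sum_(j < N.+1) z ^+ j * (a * psi j.+1).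
  by rewrite -sumrB; apply: eq_bigr => j _; rewrite mulrBr.
rewrite big_ord_recl psi0 !mulr0 add0r big_ord_recr /= psiN !mulr0 addr0.
rewrite mulrBl !mulr_sumr; congr (_ - _); apply: eq_bigr => j _.
  by rewrite /bump /= add1n exprS; ring.
by ring.
Qed.

(** The recursion is solved in its stable direction, so that no factor accumulates: if [|a| <= |b|],
    downwards from [psi N.+1 = 0] by [b psi_j = u_j + a psi_{j+1}], otherwise upwards from
    [psi 0 = 0]. *)
Lemma chain_le j : (j <= N.+1)%N ->
  cabs (psi j) * Num.max (cabs a) (cabs b) <= \sum_(i < N.+1) cabs (u i).
Proof.
move=> jN; pose s i := cabs (u i).
have s0 m n : 0 <= \sum_(m <= i < n) s i.
  by rewrite sumr_ge0 // => i _; exact: cabs_ge0.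
have -> : \sum_(i < N.+1) cabs (u i) = \sum_(0 <= i < N.+1) s i by rewrite big_mkord.
have [ab|ba] := lerP (cabs a) (cabs b).
  have key n : (n <= N.+1)%N ->
      cabs (psi (N.+1 - n)%N) * cabs b <= \sum_((N.+1 - n)%N <= i < N.+1) s i.
    elim: n => [|n IH] nN; first by rewrite subn0 psiN cabs0 mul0r s0.
    rewrite subSS big_ltn; last by rewrite ltnS leq_subr.
    have E : (N - n).+1 = (N.+1 - n)%N by rewrite subSn.
    rewrite E; apply: le_trans (lerD (lexx _) (IH (ltnW nN))).
    rewrite [leLHS]mulrC -[leLHS]cabsM.
    have -> : b * psi (N - n)%N = u (N - n)%N + a * psi (N.+1 - n)%N.
      by rewrite -E subrK.
    apply: le_trans (cabsD _ _) _; rewrite lerD2l cabsM mulrC.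
    by rewrite ler_wpM2l ?cabs_ge0.
  have := key (N.+1 - j)%N (leq_subr _ _); rewrite subKn //.
  by move/le_trans; apply; rewrite [leRHS](big_cat_nat (leq0n j)) //= lerDr.
have key n : (n <= N.+1)%N -> cabs (psi n) * cabs a <= \sum_(0 <= i < n) s i.
  elim: n => [|n IH] nN; first by rewrite psi0 cabs0 mul0r s0.
  rewrite big_nat_recr //= addrC [leLHS]mulrC -[leLHS]cabsM.
  have -> : a * psi n.+1 = - u n + b * psi n by ring.
  apply: le_trans (cabsD _ _) _; rewrite cabsN lerD2l.
  apply: le_trans (IH (ltnW nN)); rewrite cabsM mulrC.
  by rewrite ler_wpM2l ?cabs_ge0 // ltW.
apply: le_trans (key j jN) _.
by rewrite [leRHS](big_cat_nat (leq0n j)) //= lerDl.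
Qed.

End Chain.

End LinearAlgebra.

Section Estimates.
Variable R : realType.

Lemma exprD_le (a e : R) (n : nat) : 0 <= a -> 0 <= e <= 1 ->
  (a + e) ^+ n <= a ^+ n + e * (n%:R * (a + 1) ^+ n).
Proof.
move=> a0 /andP[e0 e1]; elim: n => [|n IH].
  by rewrite !expr0 mul0r mulr0 addr0.
have a1 : a ^+ n <= (a + 1) ^+ n by rewrite lerXn2r ?nnegrE; lra.
have an : 0 <= a ^+ n by rewrite exprn_ge0.
rewrite !exprS; apply: le_trans (ler_wpM2l _ IH) _; first by lra.
have n0 : 0 <= n%:R :> R by [].
rewrite -natr1; move: (a ^+ n) ((a + 1) ^+ n) (n%:R : R) n0 a1 an {IH}.
move=> x y r r0 a1 an; have y0 : 0 <= y by lra.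
have h1 : e * x <= e * ((a + 1) * y).
  rewrite ler_wpM2l //; apply: le_trans a1 _; rewrite ler_peMl //; lra.
have h2 : (a + e) * (e * (r * y)) <= (a + 1) * (e * (r * y)).
  by apply: ler_wpM2r; [rewrite !mulr_ge0|lra].
have -> : (a + e) * (x + e * (r * y)) = a * x + e * x + (a + e) * (e * (r * y)).
  by ring.
have -> : a * x + e * ((r + 1) * ((a + 1) * y)) =
  a * x + e * ((a + 1) * y) + (a + 1) * (e * (r * y)) by ring.
by rewrite -!addrA lerD2l lerD.
Qed.

(** The first summand bounds the upper deviation of [m^k] from [a^k n^l] on a small box, the second
    the lower one, in units of [n^l / A]. *)
Definition ratio_cst (Q k l : nat) : R :=
  k%:R * (Q%:R + 1) ^+ k + Q%:R ^+ k * (l%:R * (1 + 1) ^+ l).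

(** With [S = A s] the box is [a S^l <= m < (a + 1/A) S^l], [S^k <= n < (1 + 1/A) S^k]. Thus [m^k]
    and [a^k n^l] both equal [a^k S^(k l)] up to [O(S^(k l) / A)], and [S^(k l) <= n^l]. *)
Lemma small_box_ratio (A Q k l a s : nat) (p : int * int) :
  (0 < A)%N -> (0 < k)%N -> (0 < l)%N -> (a <= Q)%N ->
  in_small_box A k l a s p ->
  `|p.2%:~R ^+ l * a%:R ^+ k - p.1%:~R ^+ k| <=
  ratio_cst Q k l / A%:R * (p.2%:~R : R) ^+ l.
Proof.
move=> A0 k0 l0 aQ /andP[/andP[m1 m2] /andP[n1 n2]].
have sideE e : (0 < e)%N -> (A * side A e s = (A * s) ^ e)%N.
  by move=> e0; rewrite /side mulnA -expnS prednK // expnMn.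
pose e : R := A%:R^-1.
have AR : 0 < A%:R :> R by rewrite ltr0n.
have e0 : 0 <= e by rewrite invr_ge0.
have e1 : e <= 1 by rewrite invf_le1 // ler1n.
pose P (f : nat) : R := (A * s)%:R ^+ f.
have P0 f : 0 <= P f by rewrite exprn_ge0.
have sE f : (0 < f)%N -> (side A f s)%:R = e * P f.
  move=> f0; rewrite /P -natrX -sideE // natrM mulrA mulVf ?mul1r //.
  by rewrite gt_eqF.
have m1' : a%:R * P l <= p.1%:~R.
  move: m1; rewrite -(ler_int R); apply: le_trans.
  by rewrite -pmulrn -mulnA sideE // natrM natrX.
have m2' : p.1%:~R <= (a%:R + e) * P l.
  move: (ltW m2); rewrite -(ler_int R) -PoszD => /le_trans; apply.
  by rewrite -pmulrn natrD sE // -mulnA sideE // natrM natrX mulrDl.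
have n1' : P k <= p.2%:~R.
  by move: n1; rewrite -(ler_int R); apply: le_trans; rewrite -pmulrn sideE // natrX.
have n2' : p.2%:~R <= (1 + e) * P k.
  move: (ltW n2); rewrite -(ler_int R) -PoszD => /le_trans; apply.
  by rewrite -pmulrn natrD sE // sideE // natrX mulrDl mul1r.
pose Z : R := (A * s)%:R ^+ (l * k).
have Z0 : 0 <= Z by rewrite exprn_ge0.
have PlZ : P l ^+ k = Z by rewrite /P -exprM.
have PkZ : P k ^+ l = Z by rewrite /P -exprM [(k * l)%N]mulnC.
have mlow : a%:R ^+ k * Z <= p.1%:~R ^+ k.
  have h0 : 0 <= a%:R * P l by rewrite mulr_ge0.
  by rewrite -PlZ -exprMn lerXn2r ?nnegrE //; apply: le_trans m1'.
have mup : p.1%:~R ^+ k <= (a%:R + e) ^+ k * Z.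
  have h0 : 0 <= a%:R * P l by rewrite mulr_ge0.
  rewrite -PlZ -exprMn lerXn2r ?nnegrE //; first exact: le_trans m1'.
  by rewrite mulr_ge0 ?addr_ge0.
have nlow : Z <= p.2%:~R ^+ l.
  by rewrite -PkZ lerXn2r ?nnegrE //; apply: le_trans n1'.
have nup : p.2%:~R ^+ l <= (1 + e) ^+ l * Z.
  rewrite -PkZ -exprMn lerXn2r ?nnegrE //; first exact: le_trans n1'.
  by rewrite mulr_ge0 ?addr_ge0.
have ea := @exprD_le a%:R e k (ler0n _ _) (introT andP (conj e0 e1)).
have el := @exprD_le 1 e l ler01 (introT andP (conj e0 e1)).
rewrite expr1n in el.
have aQ' : a%:R <= Q%:R :> R by rewrite ler_nat.
have aQk : a%:R ^+ k <= Q%:R ^+ k :> R by rewrite lerXn2r ?nnegrE.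
have aQk1 : (a%:R + 1) ^+ k <= (Q%:R + 1) ^+ k :> R.
  by rewrite lerXn2r ?nnegrE ?addr_ge0 // lerD2r.
move: mlow mup nlow nup ea el aQk aQk1; rewrite /ratio_cst mulrDl mulrDl -/e.
have : 0 <= a%:R ^+ k :> R by rewrite exprn_ge0.
have : 0 <= (1 + 1) ^+ l :> R by rewrite exprn_ge0.
have : 0 <= (Q%:R + 1) ^+ k :> R by rewrite exprn_ge0.
have : 0 <= k%:R :> R by [].
have : 0 <= l%:R :> R by [].
move: (p.1%:~R ^+ k) (p.2%:~R ^+ l) (a%:R ^+ k) (Q%:R ^+ k) ((Q%:R + 1) ^+ k)
  ((a%:R + 1) ^+ k) ((a%:R + e) ^+ k) ((1 + e) ^+ l) ((1 + 1) ^+ l) k%:R l%:R.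
move=> m n ak Qk Q1k a1k aek el tl kr lr lr0 kr0 Q10 tl0 ak0.
move=> mlow mup nlow nup ea eel akQ a1Q.
have Qk0 : 0 <= Qk by apply: le_trans akQ.
have up : m - n * ak <= kr * Q1k * e * n.
  apply: (@le_trans _ _ (e * (kr * a1k) * Z)).
    have : aek * Z <= (ak + e * (kr * a1k)) * Z by rewrite ler_wpM2r.
    have : Z * ak <= n * ak by rewrite ler_wpM2r.
    by rewrite mulrDl; lra.
  have -> : kr * Q1k * e * n = e * (kr * Q1k) * n by ring.
  apply: (@le_trans _ _ (e * (kr * Q1k) * Z)).
    by rewrite ler_wpM2r // ler_wpM2l // ler_wpM2l.
  by rewrite ler_wpM2l // !mulr_ge0.
have dn : n * ak - m <= Qk * (lr * tl) * e * n.
  apply: (@le_trans _ _ (ak * (e * (lr * tl)) * Z)).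
    have : n * ak <= el * Z * ak by rewrite ler_wpM2r.
    have : el * Z * ak <= (1 + e * (lr * tl)) * Z * ak.
      by rewrite ler_wpM2r // ler_wpM2r.
    by move=> *; lra.
  have -> : Qk * (lr * tl) * e * n = Qk * (e * (lr * tl)) * n by ring.
  apply: (@le_trans _ _ (Qk * (e * (lr * tl)) * Z)).
    by rewrite ler_wpM2r // ler_wpM2r // !mulr_ge0.
  by rewrite ler_wpM2l // !mulr_ge0.
have n0 : 0 <= n by apply: le_trans nlow.
have h1 : 0 <= kr * Q1k * e * n by rewrite !mulr_ge0.
have h2 : 0 <= Qk * (lr * tl) * e * n by rewrite !mulr_ge0.
by rewrite ler_norml; apply/andP; split; lra.
Qed.

(** Since [|m| >= 1], [1 + m^2 <= 2 m^2 <= (2 r)^2]; the outer square undoes one of the two halvings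
    of the exponent. *)
Lemma sobolev_weight_le (k : nat) (m : int) (r : R) : (0 < k)%N ->
  1 <= `|m%:~R : R| <= r ->
  ((1 + m%:~R ^+ 2) `^ ((k%:R - 1) / 2 / 2)) ^+ 2 <= (2 * r) ^+ k.-1.
Proof.
move=> k0 /andP[m1 mr]; have r0 : 0 <= 2 * r by lra.
have m2 : m%:~R ^+ 2 = `|m%:~R : R| ^+ 2 by rewrite real_normK ?num_real.
have k1 : k%:R - 1 = k.-1%:R :> R by rewrite -{1}(prednK k0) -natr1 addrK.
rewrite -powR_mulrn ?powR_ge0 // -powRrM k1.
have -> : k.-1%:R / 2 / 2 * 2 = k.-1%:R / 2 :> R by field.
apply: (@le_trans _ _ (((2 * r) ^+ 2) `^ (k.-1%:R / 2))).
  apply: ge0_ler_powR; rewrite ?nnegrE ?divr_ge0 ?sqr_ge0 ?addr_ge0 ?sqr_ge0 //.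
  by rewrite m2; nra.
rewrite -powR_mulrn // -powRrM.
have -> : 2 * (k.-1%:R / 2) = k.-1%:R :> R by field.
by rewrite powR_mulrn.
Qed.

End Estimates.

(** * Lower bound for the form at one frequency *)

Section PointwiseBounds.
Variable R : realType.
Variables (k l N : nat).
Hypotheses (k0 : (0 < k)%N) (l0 : (0 < l)%N).

Definition tau : R[i] := 0 +i* (2 * pi).

Lemma cabs_tau_ge1 : 1 <= cabs tau.
Proof.
rewrite /cabs /= expr0n add0r sqrtr_sqr ger0_norm ?mulr_ge0 ?pi_ge0 //.
by have := pi_ge2 R; lra.
Qed.

Lemma tau_neq0 : tau != 0.
Proof.
apply/eqP => t0; have := cabs_tau_ge1; rewrite t0 cabs0.
by rewrite ler10.
Qed.

Lemma dmulE e (m : int) : dmul R e m = tau ^+ e * (m%:~R ^+ e)%:C.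
Proof.
rewrite /dmul rmorphXn -exprMn; congr (_ ^+ _); apply/eqP.
by rewrite eq_complex /=; apply/andP; split; apply/eqP; ring.
Qed.

Lemma cabs_dmul_ge e (m : int) : `|m%:~R| ^+ e <= cabs (dmul R e m).
Proof.
rewrite dmulE cabsM cabsX cabs_real normrX ler_peMl ?exprn_ge0 //.
by rewrite exprn_ege1 // cabs_tau_ge1.
Qed.

(** The value of [(tau m)^k / (tau n)^l] where [m^k / n^l = (i + 1)^k]. *)
Definition node (i : nat) : R[i] := tau ^+ k / tau ^+ l * (i.+1%:R ^+ k)%:C.

Lemma node_inj : injective (fun i : 'I_N.+1 => node i).
Proof.
move=> i j /= /mulfI; rewrite mulf_neq0 ?invr_eq0 ?expf_neq0 ?tau_neq0 //.
move=> /(_ isT) /(congr1 (@complex.Re R)) /= /eqP.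
rewrite eqrXn2 ?ler0n // eqr_nat eqSS => /eqP ij; exact: val_inj.
Qed.

(** Summed over all nodes, so that one constant, and hence one [A], serves every node. *)
Definition value_cst : R := cabs tau ^+ k * ratio_cst R N.+2 k l *
  \sum_(i < N.+1) \sum_(j < N) cabs (node i) ^+ j.

Lemma ratio_cst_ge0 Q : 0 <= ratio_cst R Q k l.
Proof. by rewrite addr_ge0 // !mulr_ge0 // exprn_ge0 // addr_ge0. Qed.

Lemma value_cst_ge0 : 0 <= value_cst.
Proof.
rewrite !mulr_ge0 ?ratio_cst_ge0 ?exprn_ge0 ?cabs_ge0 //.
apply: sumr_ge0 => i _; apply: sumr_ge0 => j _.
by rewrite exprn_ge0 ?cabs_ge0.
Qed.

Section AtFrequency.
Variables (A : nat) (p : int * int) (psi : nat -> R[i]).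
Hypotheses (A0 : (0 < A)%N) (psi0 : psi 0%N = 0) (psiN : psi N.+1 = 0).
Let u j := dmul R l p.2 * psi j - dmul R k p.1 * psi j.+1.
Let U := \sum_(j < N.+1) cabs (u j).

Let U0 : 0 <= U.
Proof. by apply: sumr_ge0 => j _; exact: cabs_ge0. Qed.

(** By [sum_chain] the value is [b z - a], which is [O(n^l / A)] on the box, times a combination of
    the [psi], and [chain_le] bounds each [n^l |psi j|] by [U]. *)
Lemma small_box_value (i : 'I_N.+1) s : in_small_box A k l i.+1 s p ->
  cabs (\sum_(j < N.+1) node i ^+ j * u j) <= value_cst / A%:R * U.
Proof.
move=> sp; rewrite (sum_chain _ _ psi0 psiN) cabsM.
have iN : (i.+1 <= N.+2)%N by have := ltn_ord i; lia.
have ratio := small_box_ratio R A0 k0 l0 iN sp.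
have n0 : 0 <= (p.2%:~R : R).
  move: sp => /andP[_ /andP[n1 _]]; rewrite ler0z; apply: le_trans n1.
  by rewrite le0z_nat.
have D0 : 0 <= ratio_cst R N.+2 k l / A%:R by rewrite divr_ge0 ?ratio_cst_ge0.
have -> : dmul R l p.2 * node i - dmul R k p.1 =
    tau ^+ k * (p.2%:~R ^+ l * i.+1%:R ^+ k - p.1%:~R ^+ k)%:C.
  rewrite /node !dmulE rmorphB rmorphM /= mulrBr; congr (_ - _).
  rewrite mulrACA [tau ^+ l * _]mulrCA divff ?mulr1 //.
  by rewrite expf_neq0 ?tau_neq0.
rewrite cabsM cabs_real cabsX.
have nU j : (j <= N.+1)%N -> p.2%:~R ^+ l * cabs (psi j) <= U.
  move=> jN; apply: le_trans (chain_le (dmul R k p.1) (dmul R l p.2) psi0 psiN jN).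
  rewrite mulrC ler_wpM2l ?cabs_ge0 //; apply: (@le_trans _ _ (cabs (dmul R l p.2))).
    by apply: le_trans (cabs_dmul_ge _ _); rewrite ger0_norm.
  by rewrite le_max lexx orbT.
have tau0 : 0 <= cabs tau ^+ k by rewrite exprn_ge0 ?cabs_ge0.
apply: (@le_trans _ _ (cabs tau ^+ k * (ratio_cst R N.+2 k l / A%:R) *
    (p.2%:~R ^+ l * \sum_(j < N) cabs (node i) ^+ j * cabs (psi j.+1)))).
  rewrite [leRHS]mulrA; apply: ler_pM; rewrite ?mulr_ge0 ?cabs_ge0 //.
    by rewrite -[leRHS]mulrA ler_wpM2l.
  apply: le_trans (cabs_sum _ _ _) _; apply: ler_sum => j _.
  by rewrite cabsM cabsX.
have -> : value_cst / A%:R * U = cabs tau ^+ k * (ratio_cst R N.+2 k l / A%:R) *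
    ((\sum_(i < N.+1) \sum_(j < N) cabs (node i) ^+ j) * U).
  by rewrite /value_cst; ring.
apply: ler_wpM2l; first by rewrite mulr_ge0.
rewrite (bigD1 i) //= mulrDl.
rewrite -[leLHS]addr0 lerD //; last first.
  rewrite mulr_ge0 //; apply: sumr_ge0 => ? _; apply: sumr_ge0 => ? _.
  by rewrite exprn_ge0 ?cabs_ge0.
rewrite mulr_sumr mulr_suml; apply: ler_sum => j _.
rewrite mulrCA ler_wpM2l ?exprn_ge0 ?cabs_ge0 //; apply: nU.
by have := ltn_ord j; lia.
Qed.

Variables (K : R) (T : nat).
Hypothesis K0 : 0 < K.
Hypothesis vandermondeK : forall v : nat -> R[i],
  (\sum_(j < N.+1) cabs (v j)) ^+ 2 <=
  K * \sum_(i < N.+1) cabs (\sum_(j < N.+1) node i ^+ j * v j) ^+ 2.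
Hypothesis largeA : 2 * K * (N.+1%:R * (16 * N.+2%:R ^+ 2 * 2 ^+ (l + k)) *
  value_cst ^+ 2) <= A%:R.

(* A small box costs at most a multiple of [1 / A] of what the big boxes give:
   its mass is [O(A)] times theirs, while [node]-values there are [O(1 / A)]. *)
Lemma form_lower_bound :
  big_sum R A N.+2 k l T p * U ^+ 2 / (2 * K) <=
  \sum_(i < N.+1) form_weight R A N.+2 k l i.+1 T p *
    cabs (\sum_(j < N.+1) node i ^+ j * u j) ^+ 2.
Proof.
pose v i := cabs (\sum_(j < N.+1) node i ^+ j * u j) ^+ 2.
have AR : 0 < A%:R :> R by rewrite ltr0n.
have P0 := @big_sum_ge0 R A N.+2 k l T p; set P := big_sum _ _ _ _ _ _ _ in P0 *.
(* Here [16 = 2 * 8], from [small_le_big] and [big_cst]. The [A^2] in [big_cst] cancels against the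
   squared [1 / A] of the node value, which leaves [H / A]. *)
pose H : R := 16 * N.+2%:R ^+ 2 * 2 ^+ (l + k) * value_cst ^+ 2.
have H0 : 0 <= H by apply: mulr_ge0; [rewrite !mulr_ge0|exact: sqr_ge0].
have small i : (i < N.+1)%N -> small_sum R A k l i.+1 T p * v i <= H / A%:R * P * U ^+ 2.
  move=> iN.
  have [->|[s [_ sp le1]]] := @small_le_big R A N.+2 k l A0 isT k0 i.+1 T p iN.
    rewrite mul0r; apply: mulr_ge0 (sqr_ge0 _); apply: mulr_ge0 P0.
    exact: divr_ge0.
  have vU := @small_box_value (Ordinal iN) s sp.
  have v2 : v i <= (value_cst / A%:R * U) ^+ 2.
    rewrite /v ler_sqr // nnegrE ?cabs_ge0 //; apply: mulr_ge0 U0.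
    by apply: divr_ge0 => //; exact: value_cst_ge0.
  apply: (@le_trans _ _ (2 * (big_cst A N.+2 k l)%:R / A%:R * P *
      (value_cst / A%:R * U) ^+ 2)).
    apply: ler_pM => //; last exact: sqr_ge0.
    by apply: sumr_ge0 => t _; rewrite mulr_ge0 ?invr_ge0 ?rect_density_ge0.
  rewrite le_eqVlt; apply/orP; left; apply/eqP.
  rewrite /big_cst /H !(natrM, natrX); field.
  by rewrite gt_eqF.
have sumv : U ^+ 2 / K <= \sum_(i < N.+1) v i.
  by rewrite ler_pdivrMr // mulrC; exact: (vandermondeK u).
have -> : \sum_(i < N.+1) form_weight R A N.+2 k l i.+1 T p *
    cabs (\sum_(j < N.+1) node i ^+ j * u j) ^+ 2 =
    P * (\sum_(i < N.+1) v i) - \sum_(i < N.+1) small_sum R A k l i.+1 T p * v i.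
  by rewrite mulr_sumr -sumrB; apply: eq_bigr => i _; rewrite -mulrBl.
(* [largeA] is exactly what makes the subtracted part at most half of the Vandermonde lower
   bound. *)
have le2 : \sum_(i < N.+1) small_sum R A k l i.+1 T p * v i <=
    P * U ^+ 2 / (2 * K).
  apply: (@le_trans _ _ (\sum_(i < N.+1) H / A%:R * P * U ^+ 2)).
    by apply: ler_sum => i _; apply: small.
  rewrite sumr_const card_ord -[leLHS]mulr_natl.
  have -> : N.+1%:R * (H / A%:R * P * U ^+ 2) =
    (N.+1%:R * H / A%:R) * (P * U ^+ 2) by ring.
  rewrite [leRHS]mulrC ler_wpM2r ?mulr_ge0 ?sqr_ge0 //.
  rewrite ler_pdivrMr // ler_pdivlMl ?mulr_gt0 //.
  apply: le_trans largeA; rewrite le_eqVlt; apply/orP; left; apply/eqP.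
  by rewrite /H; ring.
have le3 : P * (U ^+ 2 / K) <= P * \sum_(i < N.+1) v i by rewrite ler_wpM2l.
have E : P * (U ^+ 2 / K) = P * U ^+ 2 / (2 * K) + P * U ^+ 2 / (2 * K).
  by field; rewrite gt_eqF.
lra.
Qed.

End AtFrequency.

End PointwiseBounds.

(** * From the total density of the big boxes to the Sobolev weight *)

Section SobolevTerm.
Variable R : realType.

(** The least admissible [t] is the anisotropic size of a frequency: for [t >= 2], [t - 1] violates
    one of the two inequalities, and [t <= 2 (t - 1)]. *)
Lemma scale_exists (k l M M' : nat) : (0 < k)%N -> (0 < l)%N ->
  (0 < M)%N -> (0 < M')%N ->
  exists t, [/\ (0 < t <= maxn M M')%N, (M <= t ^ l)%N, (M' <= t ^ k)%N &
    (t ^ (k * l) <= 2 ^ (k * l) * maxn (M ^ k) (M' ^ l))%N].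
Proof.
move=> k0 l0 M0 M0'.
have leX x e : (0 < e)%N -> (0 < x)%N -> (x <= x ^ e)%N.
  by move=> e0 x0; rewrite -{1}[x]expn1 leq_pexp2l.
pose P t := [&& (0 < t)%N, (M <= t ^ l)%N & (M' <= t ^ k)%N].
have m0 : (0 < maxn M M')%N by rewrite leq_max M0.
have exP : exists t, P t.
  exists (maxn M M'); rewrite /P m0 /=; apply/andP; split.
    by apply: leq_trans (leX _ _ l0 m0); rewrite leq_maxl.
  by apply: leq_trans (leX _ _ k0 m0); rewrite leq_maxr.
have [t /and3P[t0 Mt Mt'] tmin] := ex_minnP exP; exists t; split=> //.
  rewrite t0 /=; apply: tmin; rewrite /P m0 /=; apply/andP; split.
    by apply: leq_trans (leX _ _ l0 m0); rewrite leq_maxl.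
  by apply: leq_trans (leX _ _ k0 m0); rewrite leq_maxr.
have [t1|t1] := leqP t 1.
  have -> : t = 1%N by lia.
  by rewrite exp1n muln_gt0 expn_gt0 leq_max expn_gt0 M0.
have nP : ~~ P t.-1 by apply/negP => /tmin; lia.
have big : (t.-1 ^ (k * l) <= maxn (M ^ k) (M' ^ l))%N.
  move: nP; rewrite /P negb_and negb_and -!ltnNge.
  case/or3P => [|h|h]; first by lia.
    by rewrite leq_max mulnC expnM leq_expl // ltnW.
  by rewrite leq_max expnM [X in _ || X]leq_expl ?orbT // ltnW.
apply: leq_trans (leq_mul (leqnn _) big); rewrite -expnMn leq_expl //; lia.
Qed.

Definition term_cst (A Q k l : nat) : R :=
  2 ^+ (k.-1 + l.-1) * 2 ^+ (2 * (k * l)) *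
  (big_cst A Q k l * (side A l A * side A k A))%:R.

(** The exponents balance: up to constants the squared weight is at most [t^(l (k - 1) + k (l - 1))
    = t^(2 k l - k - l)], while [U >= t^(k l) f] and [big_sum >= t^(- k - l)]. *)
Lemma sobolev_term_le (A Q k l T : nat) (p : int * int) (f U : R) :
  (0 < A)%N -> (1 < Q)%N -> (0 < k)%N -> (0 < l)%N ->
  p.1 != 0 -> p.2 != 0 -> 0 <= f ->
  f * Num.max (`|p.1%:~R| ^+ k) (`|p.2%:~R| ^+ l) <= U ->
  (A * maxn `|p.1| `|p.2| < T)%N ->
  ((1 + p.1%:~R ^+ 2) `^ ((k%:R - 1) / 2 / 2) *
   (1 + p.2%:~R ^+ 2) `^ ((l%:R - 1) / 2 / 2) * f) ^+ 2 <=
  term_cst A Q k l * (big_sum R A Q k l T p * U ^+ 2).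
Proof.
move=> A0 Q1 k0 l0 m0 n0 f0 fU AT.
have M0 : (0 < `|p.1|)%N by rewrite absz_gt0.
have M0' : (0 < `|p.2|)%N by rewrite absz_gt0.
have [t [/andP[t0 tM] mt nt tkl]] := scale_exists k0 l0 M0 M0'.
have absE (m : int) : `|m%:~R| = `|m|%N%:R :> R by rewrite -intr_norm -natr_absz.
have wm : ((1 + p.1%:~R ^+ 2) `^ ((k%:R - 1) / 2 / 2)) ^+ 2 <=
    (2 * t%:R ^+ l) ^+ k.-1 :> R.
  by apply: sobolev_weight_le; rewrite // absE ler1n M0 -natrX ler_nat.
have wn : ((1 + p.2%:~R ^+ 2) `^ ((l%:R - 1) / 2 / 2)) ^+ 2 <=
    (2 * t%:R ^+ k) ^+ l.-1 :> R.
  by apply: sobolev_weight_le; rewrite // absE ler1n M0' -natrX ler_nat.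
have U0 : 0 <= U.
  by apply: le_trans fU; rewrite mulr_ge0 // le_max exprn_ge0.
have ft : t%:R ^+ (k * l) * f <= 2 ^+ (k * l) * U.
  apply: le_trans (ler_wpM2l _ fU); last by rewrite exprn_ge0.
  rewrite mulrC mulrCA ler_wpM2l //.
  have -> : Num.max (`|p.1%:~R| ^+ k) (`|p.2%:~R| ^+ l) =
      (maxn (`|p.1| ^ k) (`|p.2| ^ l))%:R :> R.
    by rewrite !absE -!natrX natr_max.
  by rewrite -!natrX -natrM ler_nat.
have tR : 0 < t%:R :> R by rewrite ltr0n.
have lhs : ((1 + p.1%:~R ^+ 2) `^ ((k%:R - 1) / 2 / 2) *
   (1 + p.2%:~R ^+ 2) `^ ((l%:R - 1) / 2 / 2) * f) ^+ 2 * t%:R ^+ (l + k) <=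
   2 ^+ (k.-1 + l.-1) * 2 ^+ (2 * (k * l)) * U ^+ 2.
  rewrite !exprMn.
  apply: (@le_trans _ _ ((2 * t%:R ^+ l) ^+ k.-1 * (2 * t%:R ^+ k) ^+ l.-1 *
      f ^+ 2 * t%:R ^+ (l + k))).
    rewrite ler_wpM2r ?exprn_ge0 // ler_wpM2r ?sqr_ge0 //.
    by rewrite ler_pM ?sqr_ge0.
  have -> : (2 * t%:R ^+ l) ^+ k.-1 * (2 * t%:R ^+ k) ^+ l.-1 *
      f ^+ 2 * t%:R ^+ (l + k) =
      2 ^+ (k.-1 + l.-1) * (t%:R ^+ (k * l) * f) ^+ 2.
    have -> : (t%:R ^+ (k * l) * f) ^+ 2 =
        t%:R ^+ (l * k.-1) * t%:R ^+ (k * l.-1) * t%:R ^+ (l + k) * f ^+ 2.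
      rewrite exprMn -exprM -!exprD; congr (_ ^+ _ * _).
      by case: k l k0 l0 {wm wn mt nt tkl fU ft AT} => // k' [] // l' _ _ /=; ring.
    by rewrite !exprMn -!exprM !exprD; ring.
  rewrite -mulrA; apply: ler_wpM2l; first by rewrite exprn_ge0.
  rewrite [(2 * (k * l))%N]mulnC [2 ^+ (k * l * 2)]exprM -[leRHS]exprMn.
  by rewrite ler_sqr ?nnegrE ?mulr_ge0 ?exprn_ge0.
(* Passing to [t A] meets the constraint [A <= s] and costs only the factor [side e A], which is
   free of [t]. *)
pose s := (t * A)%N.
have As : (A <= s)%N by rewrite leq_pmull.
have ts : (t <= s)%N by rewrite leq_pmulr.
have sT : (s < T)%N.
  by apply: leq_ltn_trans AT; rewrite /s mulnC leq_mul2l tM orbT.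
have s0 : (0 < s)%N by lia.
have box e (x : int) : (`|x| <= t ^ e)%N ->
    - (Q * A * side A e s)%:Z <= x < (Q * A * side A e s)%:Z.
  move=> xt; have h : (t ^ e < Q * A * side A e s)%N.
    apply: leq_ltn_trans (leq_expl e ts) _; rewrite /side.
    have := expn_gt0 s e; rewrite s0 /= => se0.
    have Ae0 : (0 < A ^ e.-1)%N by rewrite expn_gt0 A0.
    have h2 : (s ^ e <= A ^ e.-1 * s ^ e)%N by rewrite leq_pmull.
    apply: leq_ltn_trans h2 _; rewrite -[X in (X < _)%N]mul1n ltn_mul2r.
    by rewrite muln_gt0 Ae0 se0 /=; nia.
  by lia.
have sp : in_big_box A Q k l s p by apply/andP; split; exact: box.
have low := @big_sum_ge R A Q k l A0 Q1 k0 s T p As sT sp.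
have sE e : side A e s = (t ^ e * side A e A)%N.
  by rewrite /s /side expnMn; ring.
rewrite sE [side A k s]sE in low.
have low' : 1 <= (big_cst A Q k l * (side A l A * side A k A))%:R *
    t%:R ^+ (l + k) * big_sum R A Q k l T p.
  have c0 : (0 < big_cst A Q k l * (t ^ l * side A l A * (t ^ k * side A k A)))%N.
    by rewrite /big_cst !(muln_gt0, expn_gt0) A0 t0 (ltnW Q1).
  move: low; rewrite -[leLHS]mul1r ler_pdivrMr ?ltr0n // => /le_trans; apply.
  have -> : (big_cst A Q k l * (t ^ l * side A l A * (t ^ k * side A k A)) =
      big_cst A Q k l * (side A l A * side A k A) * t ^ (l + k))%N.
    by rewrite expnD; ring.
  by rewrite natrM natrX mulrC.
move: lhs low'; rewrite /term_cst.
set x := (_ * _ * f) ^+ 2; set P := big_sum _ _ _ _ _ _ _.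
set c : R := (big_cst A Q k l * (side A l A * side A k A))%:R.
set y : R := t%:R ^+ (l + k); set d : R := 2 ^+ (k.-1 + l.-1) * 2 ^+ (2 * (k * l)).
move=> lhs low'.
have c0 : 0 <= c by exact: ler0n.
have P0 : 0 <= P by exact: big_sum_ge0.
have x0 : 0 <= x by exact: sqr_ge0.
apply: (@le_trans _ _ (x * y * (c * P))).
  rewrite -[leLHS]mulr1; apply: le_trans (ler_wpM2l x0 low') _.
  by rewrite le_eqVlt; apply/orP; left; apply/eqP; ring.
apply: le_trans (ler_wpM2r (mulr_ge0 c0 P0) lhs) _.
by rewrite le_eqVlt; apply/orP; left; apply/eqP; ring.
Qed.

End SobolevTerm.

(** * Summation over frequencies *)

Lemma ler_sum_subseq_uniq (R : numDomainType) (I : eqType) (s r : seq I) (F : I -> R) :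
  uniq s -> uniq r -> {subset s <= r} -> (forall i, 0 <= F i) ->
  \sum_(i <- s) F i <= \sum_(i <- r) F i.
Proof.
move=> us ur sr F0.
have -> : \sum_(i <- s) F i = \sum_(i <- r | i \in s) F i.
  rewrite -[RHS]big_filter; apply: perm_big; apply: uniq_perm => //.
    exact: filter_uniq.
  by move=> i; rewrite mem_filter; case: (boolP (i \in s)) => // /sr ->.
by rewrite big_mkcond; apply: ler_sum => i _; case: ifP.
Qed.

Section Assembly.
Variable R : realType.

Lemma cm_norm_ge0 (mu : cmeasure R) : (0 <= cm_norm mu)%E.
Proof.
apply: ereal_sup_ubound; exists [::]; last by rewrite big_nil.
by split=> [E|i j] //=; rewrite ltn0 andbF.
Qed.

Lemma W2norm_le (a b D : R) (f : int -> int -> R[i]) : 0 <= D ->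
  (forall s : seq (int * int), uniq s ->
    \sum_(p <- s) ((1 + p.1%:~R ^+ 2) `^ (a / 2) * (1 + p.2%:~R ^+ 2) `^ (b / 2)
      * cabs (f p.1 p.2)) ^+ 2 <= D ^+ 2) ->
  (W2norm a b f <= D%:E)%E.
Proof.
move=> D0 fD; rewrite /W2norm; set S := esum _ _.
have S0 : (0 <= S)%E by apply: esum_ge0 => p _; rewrite lee_fin sqr_ge0.
have SD : (S <= (D ^+ 2)%:E)%E.
  apply: ub_ereal_sup => _ [X [finX _] <-].
  by rewrite fsbig_finite // sumEFin lee_fin fD // finmap.fset_uniq.
case: S S0 SD => [r| |] //; rewrite !lee_fin => r0 rD.
by rewrite -[leRHS]ger0_norm // -sqrtr_sqr ler_wsqrtr.
Qed.

Variables (k l N : nat).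
Hypotheses (k0 : (0 < k)%N) (l0 : (0 < l)%N) (N0 : (0 < N)%N).

(** Controls the squared total variations of the combinations [sum_j z_i^j mu_j], relative to the
    sum of the norms. *)
Definition node_cst : R :=
  \sum_(i < N.+1) (\sum_(j < N.+1) cabs (node R k l i ^+ j)) ^+ 2.

Section Solution.
Variables (phi : nat -> int -> int -> R[i]) (mu : nat -> cmeasure R).
Hypothesis proper : forall j, (1 <= j <= N)%N -> proper_distr (phi j).
Hypothesis eq0 : forall m n : int, - (dmul R k m * phi 1%N m n) = fcoef (mu 0%N) m n.
Hypothesis eqj : forall j : nat, (1 <= j < N)%N -> forall m n : int,
  dmul R l n * phi j m n - dmul R k m * phi j.+1 m n = fcoef (mu j) m n.
Hypothesis eqN : forall m n : int, dmul R l n * phi N m n = fcoef (mu N) m n.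

(** Zeros at 0 and [N + 1] turn the two end equations into instances of the middle one. *)
Definition padded (p : int * int) (j : nat) : R[i] :=
  if (1 <= j <= N)%N then phi j p.1 p.2 else 0.

Lemma padded_eq p j : (j <= N)%N -> fcoef (mu j) p.1 p.2 =
  dmul R l p.2 * padded p j - dmul R k p.1 * padded p j.+1.
Proof.
move=> jN; rewrite /padded; case: j jN => [|j] jN.
  by rewrite N0 /= mulr0 sub0r -eq0.
rewrite jN /=; case: ltnP => jN'; first by rewrite -eqj.
have -> : j.+1 = N by lia.
by rewrite mulr0 subr0 -eqN.
Qed.

Variables (W : nat -> R) (K : R) (A : nat).
Hypothesis muW : forall j, (j < N.+1)%N -> cm_norm (mu j) = (W j)%:E.
Hypothesis W0 : forall j, 0 <= W j.
Hypothesis K0 : 0 < K.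
Hypothesis vandermondeK : forall v : nat -> R[i],
  (\sum_(j < N.+1) cabs (v j)) ^+ 2 <=
  K * \sum_(i < N.+1) cabs (\sum_(j < N.+1) node R k l i ^+ j * v j) ^+ 2.
Hypothesis A0 : (0 < A)%N.
Hypothesis largeA : 2 * K * (N.+1%:R * (16 * N.+2%:R ^+ 2 * 2 ^+ (l + k)) *
  value_cst R k l N ^+ 2) <= A%:R.

Let Wsum : R := \sum_(j < N.+1) W j.
Let comb (i : nat) := comb_fcoef N.+1 mu (fun j => node R k l i ^+ j).
Let form T p : R :=
  \sum_(i < N.+1) form_weight R A N.+2 k l i.+1 T p * cabs (comb i p) ^+ 2.

Let U p : R := \sum_(j < N.+1)
  cabs (dmul R l p.2 * padded p j - dmul R k p.1 * padded p j.+1).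

Lemma form_ge T p : big_sum R A N.+2 k l T p * U p ^+ 2 / (2 * K) <= form T p.
Proof.
have p0 : padded p 0 = 0 by [].
have pN : padded p N.+1 = 0 by rewrite /padded ltnn andbF.
have := @form_lower_bound R k l N k0 l0 A p (padded p) A0 p0 pN K T K0
  vandermondeK largeA.
move/le_trans; apply; rewrite le_eqVlt; apply/orP; left; apply/eqP.
apply: eq_bigr => i _; congr (_ * cabs _ ^+ 2).
by apply: eq_bigr => j _; rewrite padded_eq // -ltnS.
Qed.

Lemma form_ge0 T p : 0 <= form T p.
Proof.
apply: le_trans (form_ge T p).
apply: divr_ge0; last by rewrite mulr_ge0 // ltW.
by apply: mulr_ge0 (sqr_ge0 _); exact: big_sum_ge0.
Qed.

Lemma form_sum_le T B : (A <= T)%N ->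
  (N.+2 * A * side A l (2 * T) <= B)%N -> (N.+2 * A * side A k (2 * T) <= B)%N ->
  \sum_(p <- zbox B) form T p <= kernel_bound R A N.+2 * node_cst * Wsum ^+ 2.
Proof.
move=> AT Bl Bk; rewrite exchange_big /= /node_cst mulr_sumr mulr_suml.
apply: ler_sum => i _.
have kb0 : 0 <= kernel_bound R A N.+2 by rewrite addr_ge0 // mulr_ge0.
have kernel x y := @cabs_kernel_le R A N.+2 k l A0 isT k0 l0 i.+1 T B x y
  (ltn_ord i) AT Bl Bk.
apply: le_trans (@quadratic_form_le R N.+1 mu W (fun j => node R k l i ^+ j)
  muW _ _ _ kernel) _.
rewrite -mulrA ler_wpM2l // -exprMn ler_sqr ?nnegrE; last 2 first.
- by apply: sumr_ge0 => j _; rewrite mulr_ge0 ?cabs_ge0.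
- by rewrite mulr_ge0 // sumr_ge0 // => j _; rewrite cabs_ge0.
rewrite /comb_norm mulr_suml; apply: ler_sum => j _.
rewrite ler_wpM2l ?cabs_ge0 // /Wsum (bigD1 j) //= lerDl.
by apply: sumr_ge0.
Qed.

Lemma phi_term_le T j p : (1 <= j <= N)%N -> (A * maxn `|p.1| `|p.2| < T)%N ->
  ((1 + p.1%:~R ^+ 2) `^ ((k%:R - 1) / 2 / 2) *
   (1 + p.2%:~R ^+ 2) `^ ((l%:R - 1) / 2 / 2) * cabs (phi j p.1 p.2)) ^+ 2 <=
  term_cst R A N.+2 k l * (2 * K) * form T p.
Proof.
move=> jN AT.
have t0 : 0 <= term_cst R A N.+2 k l by rewrite !mulr_ge0 ?exprn_ge0.
(* On the axes the coefficient vanishes by properness; off them [|m|, |n| >= 1], as the weight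
   estimate requires. *)
have [pz|] := boolP ((p.1 == 0) || (p.2 == 0)).
  rewrite proper //; last by case/orP: pz => /eqP; [left|right].
  by rewrite cabs0 mulr0 expr0n /= !mulr_ge0 ?form_ge0 // ltW.
rewrite negb_or => /andP[m0 n0].
apply: (@le_trans _ _ (term_cst R A N.+2 k l *
   (big_sum R A N.+2 k l T p * U p ^+ 2))).
  apply: sobolev_term_le => //; first exact: cabs_ge0.
  have p0 : padded p 0 = 0 by [].
  have pN : padded p N.+1 = 0 by rewrite /padded ltnn andbF.
  have jN' : (j <= N.+1)%N by lia.
  apply: le_trans (chain_le (dmul R k p.1) (dmul R l p.2) p0 pN jN').
  rewrite /padded jN ler_wpM2l ?cabs_ge0 // ge_max !le_max !cabs_dmul_ge orbT.
  by [].
rewrite -mulrA; apply: ler_wpM2l => //.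
by rewrite [leRHS]mulrC -ler_pdivrMr ?mulr_gt0 // form_ge.
Qed.

(** Finitely many frequencies are covered by a large [T]; as [form] is nonnegative, the sum extends
    to a full box, where the kernel estimate has a constant free of [T]. *)
Lemma W2norm_phi_le j : (1 <= j <= N)%N ->
  (W2norm ((k%:R - 1) / 2) ((l%:R - 1) / 2) (phi j) <=
   (Num.sqrt (term_cst R A N.+2 k l * (2 * K) *
     (kernel_bound R A N.+2 * node_cst)) * Wsum)%:E)%E.
Proof.
move=> jN; have Ws0 : 0 <= Wsum by apply: sumr_ge0.
have t0 : 0 <= term_cst R A N.+2 k l * (2 * K).
  by rewrite mulr_ge0 // ?mulr_ge0 ?exprn_ge0 // ltW.
have c0 : 0 <= kernel_bound R A N.+2 * node_cst.
  rewrite mulr_ge0 ?addr_ge0 ?mulr_ge0 //; apply: sumr_ge0 => i _; exact: sqr_ge0.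
apply: W2norm_le => [|s us]; first by rewrite mulr_ge0 ?sqrtr_ge0.
rewrite exprMn sqr_sqrtr; last exact: mulr_ge0.
rewrite -[leRHS]mulrA.
pose M := (\max_(p <- s) maxn `|p.1| `|p.2|)%N.
have sM p : p \in s -> (maxn `|p.1| `|p.2| <= M)%N by move=> ps; exact: leq_bigmax_seq.
pose T := (A * M.+1).+1.
(* [zbox B] must contain all big boxes and [s]; it omits its right end, hence [M.+1]. *)
pose B := (N.+2 * A * side A l (2 * T) + N.+2 * A * side A k (2 * T) + M.+1)%N.
apply: (@le_trans _ _ (\sum_(p <- zbox B) term_cst R A N.+2 k l * (2 * K) * form T p)).
  apply: (@le_trans _ _ (\sum_(p <- s) term_cst R A N.+2 k l * (2 * K) * form T p)).
    rewrite big_seq [leRHS]big_seq; apply: ler_sum => p ps.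
    apply: phi_term_le => //; rewrite /T ltnS leq_mul2l; apply/orP; right.
    exact: leq_trans (sM _ ps) (leqnSn _).
  apply: ler_sum_subseq_uniq; rewrite ?zbox_uniq //.
    by move=> p /sM; rewrite mem_zbox geq_max /B; lia.
  by move=> p; rewrite mulr_ge0 // form_ge0.
rewrite -mulr_sumr ler_wpM2l //; apply: form_sum_le; rewrite /B /T.
- by rewrite mulnS; lia.
- by rewrite -addnA leq_addr.
- by rewrite -addnA addnCA leq_addr.
Qed.

End Solution.

End Assembly.

Theorem theorem2 (R : realType) (k l N : nat) :
  (0 < k)%N -> (0 < l)%N -> (0 < N)%N -> odd k || odd l ->
  exists C : R, forall (phi : nat -> int -> int -> R[i]) (mu : nat -> cmeasure R),
    (forall j : nat, (1 <= j <= N)%N -> is_distribution (phi j) /\ proper_distr (phi j)) ->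
    (forall m n : int, - (dmul R k m * phi 1%N m n) = fcoef (mu 0%N) m n) ->
    (forall j : nat, (1 <= j < N)%N -> forall m n : int,
        dmul R l n * phi j m n - dmul R k m * phi j.+1 m n = fcoef (mu j) m n) ->
    (forall m n : int, dmul R l n * phi N m n = fcoef (mu N) m n) ->
    (\sum_(1 <= j < N.+1) W2norm ((k%:R - 1) / 2) ((l%:R - 1) / 2) (phi j)
      <= C%:E * \sum_(0 <= j < N.+1) cm_norm (mu j))%E.
Proof.
move=> k0 l0 N0 _.
have [K K0 vdm] := vandermonde_lower_bound (@node_inj R k l N k0).
pose H : R := 2 * K * (N.+1%:R * (16 * N.+2%:R ^+ 2 * 2 ^+ (l + k)) *
  value_cst R k l N ^+ 2).
have H0 : 0 <= H.
  apply: mulr_ge0; first by rewrite mulr_ge0 // ltW.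
  by apply: mulr_ge0 (sqr_ge0 _); rewrite !mulr_ge0.
(* [H] depends only on [k], [l], [N] and the nodes, so [A] is fixed before [phi] and [mu]. *)
pose A := (Num.truncn H).+1.
have largeA : H <= A%:R by case/andP: (truncn_itv H0) => _ /ltW.
pose D : R := Num.sqrt (term_cst R A N.+2 k l * (2 * K) *
     (kernel_bound R A N.+2 * node_cst R k l N)).
have D0 : 0 <= D by exact: sqrtr_ge0.
(* The [+ 1] makes the constant positive, so that the right-hand side is [+oo] as soon as one norm
   is. *)
exists (N%:R * D + 1) => phi mu distr eq0 eqj eqN.
have C0 : 0 < N%:R * D + 1 by rewrite ltr_wpDl // mulr_ge0.
have [[j jN muy]|fin] := pselect (exists2 j, (j < N.+1)%N & cm_norm (mu j) = +oo%E).
  have -> : (\sum_(0 <= j < N.+1) cm_norm (mu j) = +oo)%E.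
    apply/eqP; rewrite -leye_eq -muy big_mkord (bigD1 (Ordinal jN)) //= leeDl //.
    by apply: sume_ge0 => i _; exact: cm_norm_ge0.
  by rewrite gt0_muley ?lte_fin // leey.
pose W j := fine (cm_norm (mu j)).
have muW j : (j < N.+1)%N -> cm_norm (mu j) = (W j)%:E.
  move=> jN; rewrite fineK // ge0_fin_numE ?cm_norm_ge0 // ltey.
  by apply/eqP => muy; apply: fin; exists j.
have W0 j : 0 <= W j by rewrite fine_ge0 // cm_norm_ge0.
have proper j : (1 <= j <= N)%N -> proper_distr (phi j) by move=> /distr[].
have key := @W2norm_phi_le R k l N k0 l0 N0 phi mu proper eq0 eqj eqN W K A
  muW W0 K0 vdm isT largeA.
have -> : (\sum_(0 <= j < N.+1) cm_norm (mu j) = (\sum_(j < N.+1) W j)%:E)%E.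
  by rewrite big_mkord -sumEFin; apply: eq_bigr => j _; rewrite muW.
set Ws : R := \sum_(j < N.+1) W j; have Ws0 : 0 <= Ws by apply: sumr_ge0.
apply: (@le_trans _ _ (\sum_(1 <= j < N.+1) (D * Ws)%:E)%E).
  rewrite big_nat_cond [leRHS]big_nat_cond.
  by apply: lee_sum => j /andP[/andP[j1 jN] _]; apply: key; rewrite j1 -ltnS.
rewrite sumEFin sumr_const_nat subn1 /= -EFinM lee_fin -[leLHS]mulr_natl mulrA.
by rewrite ler_wpM2r // lerDl.
Qed.
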